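(* Let $\mathcal G$ be a graph of groups with 2-ended edge groups such that none of the vertex groups contains a distorted (infinite) cyclic subgroup. Then $\pi_1(\mathcal G)$ contains a non-Euclidean almost Baumslag--Solitar subgroup if and only if $\mathcal G$ has an unbalanced edge.
   Context: Graphs of groups have finite connected underlying graph, vertex groups $G_v$, edge groups $G_e$ and injective edge maps $\phi_{e^\pm}\colon G_e\to G_{e^\pm}$. Vertex groups are finitely generated so that distortion makes sense: an infinite cyclic subgroup $\langle g\rangle$ of a finitely generated group is distorted if $n\mapsto g^n$ is not a quasi-isometric embedding (word metric). A non-Euclidean almost Baumslag--Solitar group is a group generated by two infinite order elements $a,s$ such that $sa^is^{-1}=a^j$ holds for some $i,j\neq0$ with $|i|\ne|j|$. Balanced edge: let $e$ be an edge of $\mathcal G$, $\mathcal H=\mathcal G-e$, and let $\phi_+,\phi_-\colon G_e\to\pi_1(\mathcal H)$ be the morphisms associated to $e$ (the edge maps followed by inclusions of vertex groups). The edge $e$ is balanced if for every infinite order $a\in G_e$, whenever there is $h\in\pi_1(\mathcal H)$ with $h\phi_+(a)^ih^{-1}=\phi_-(a)^j$, it follows that $|i|=|j|$. Otherwise it is unbalanced. If removing $e$ disconnects the graph, $e$ is regarded as balanced. *)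

(* Defs.v *)
From HB Require Import structures.
From mathcomp Require Import all_boot all_order all_algebra.
From mathcomp Require Import boolp classical_sets cardinality.

Set Implicit Arguments.
Unset Strict Implicit.
Unset Printing Implicit Defensive.

Local Open Scope group_scope.
Local Open Scope quotient_scope.

Section Groups.
Variable G : groupType.
Implicit Types (g x y : G) (S K : seq G).

Definition expgz g (m : int) : G :=
  match m with Posz n => g ^+ n | Negz n => g ^- n.+1 end.

Definition infinite_order g : Prop := forall n : nat, (0 < n)%N -> g ^+ n <> 1.

Definition subgroup (H : set G) : Prop :=
  H 1 /\ forall x y, H x -> H y -> H (x / y).

Definition generated (A : set G) : set G := smallest subgroup A.

Definition generates S : Prop := generated [set` S]%classic = [set: G]%classic.

Definition finitely_generated : Prop := exists S, generates S.

Definition has_word_of_size S x (n : nat) : Prop :=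
  exists w : seq G,
    [/\ {in w, forall s, (s \in S) || (s^-1 \in S)},
        \prod_(s <- w) s = x & size w = n].

(* Meaningful only for [x] in the subgroup generated by [S]; 0 otherwise. *)
Definition word_norm S x : nat :=
  xget 0%N [set n | has_word_of_size S x n /\
                    forall m, has_word_of_size S x m -> (n <= m)%N]%classic.

Definition word_metric S x y : nat := word_norm S (x^-1 * y).

Definition cayley_adj S : rel G :=
  fun x y => (x^-1 * y \in S) || (y^-1 * x \in S).

Definition joined_outside S K x y : Prop :=
  exists p : seq G,
    [/\ path (cayley_adj S) x p, last x p = y & {in x :: p, forall z, z \notin K}].

(* The number of ends of the Cayley graph is the supremum, over finite sets [K]
   of vertices, of the number of infinite components of the complement of [K]. *)
Definition at_least_ends S (n : nat) : Prop :=
  exists (K : seq G) (x : 'I_n -> G),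
    (forall i, infinite_set [set y | joined_outside S K (x i) y]%classic) /\
    (forall i j, i != j -> ~ joined_outside S K (x i) (x j)).

Definition two_ended : Prop :=
  exists2 S, generates S & at_least_ends S 2 /\ ~ at_least_ends S 3.

End Groups.

(* Natural constants are enough: any real constants can be rounded up.  The
   second inequality is [dX x y / L - C <= dY (f x) (f y)]. *)
Definition quasi_isometric_embedding (X Y : Type)
    (dX : X -> X -> nat) (dY : Y -> Y -> nat) (f : X -> Y) : Prop :=
  exists L C : nat, (0 < L)%N /\
    forall x y : X, (dY (f x) (f y) <= L * dX x y + C)%N /\
                    (dX x y <= L * (dY (f x) (f y) + C))%N.

(* For finitely generated groups the choice of [S] is irrelevant, up to
   quasi-isometry. *)
Definition distorted (G : groupType) (g : G) : Prop :=
  infinite_order g /\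
  exists2 S : seq G, generates S &
    ~ quasi_isometric_embedding (fun m n : int => absz (m - n)%R)
        (word_metric S) (expgz g).

Definition non_Euclidean_almost_BS (G : groupType) (H : set G) : Prop :=
  exists a s : G,
    [/\ infinite_order a, infinite_order s, H = generated [set a; s]%classic &
        exists i j : int,
          [/\ i <> 0%R, j <> 0%R, absz i <> absz j &
              s * expgz a i * s^-1 = expgz a j]].

(* [endp e] and [endm e] are the endpoints e^+ and e^-; loops and multiple edges
   are allowed.  Connectedness is required separately, since removing an edge
   may destroy it. *)
Record graph_of_groups := GraphOfGroups {
  vertex : finType;
  edge : finType;
  endp : edge -> vertex;
  endm : edge -> vertex;
  vgroup : vertex -> groupType;
  egroup : edge -> groupType;
  phip : forall e : edge, {multiplicative egroup e -> vgroup (endp e)};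
  phim : forall e : edge, {multiplicative egroup e -> vgroup (endm e)};
  phip_inj : forall e : edge, injective (phip e);
  phim_inj : forall e : edge, injective (phim e)
}.

Section UnderlyingGraph.
Variable GG : graph_of_groups.
Implicit Types (A T : {set edge GG}).

Definition adj A : rel (vertex GG) := fun u v =>
  [exists e in A, (endp e == u) && (endm e == v)
               || (endp e == v) && (endm e == u)].

Definition connected_by A : Prop :=
  (0 < #|vertex GG|)%N /\ forall u v, connect (adj A) u v.

Definition connected_graph : Prop := connected_by [set: edge GG]%SET.

(* No edge of [A] closes a cycle in [A]. *)
Definition acyclic A : Prop :=
  forall e, e \in A -> ~~ connect (adj (A :\ e)%SET) (endp e) (endm e).

Definition spanning_tree T : Prop := connected_by T /\ acyclic T.

End UnderlyingGraph.

Section FundamentalGroup.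
Variables (GG : graph_of_groups) (T : {set edge GG}).

(* [inr (e, true)] stands for the stable letter [t_e] and [inr (e, false)] for
   its inverse. *)
Definition letter : Type := ({v : vertex GG & vgroup v} + edge GG * bool)%type.

Definition vletter (v : vertex GG) (g : vgroup v) : letter :=
  inl (existT (fun v : vertex GG => vgroup v) v g).

Definition eletter (e : edge GG) (b : bool) : letter := inr (e, b).

Inductive pi1_rel : seq letter -> seq letter -> Prop :=
| pi1_one v : pi1_rel [:: vletter (1 : vgroup v)] [::]
| pi1_mul v (g h : vgroup v) :
    pi1_rel [:: vletter g; vletter h] [:: vletter (g * h)]
| pi1_cancel e b : pi1_rel [:: eletter e b; eletter e (~~ b)] [::]
| pi1_edge e (g : egroup e) :
    pi1_rel [:: eletter e true; vletter (phip e g); eletter e false]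
            [:: vletter (phim e g)]
| pi1_tree e : e \in T -> pi1_rel [:: eletter e true] [::]
| pi1_refl w : pi1_rel w w
| pi1_sym w1 w2 : pi1_rel w1 w2 -> pi1_rel w2 w1
| pi1_trans w1 w2 w3 : pi1_rel w1 w2 -> pi1_rel w2 w3 -> pi1_rel w1 w3
| pi1_cat w1 w2 w3 w4 :
    pi1_rel w1 w2 -> pi1_rel w3 w4 -> pi1_rel (w1 ++ w3) (w2 ++ w4).

Definition pi1_relb : rel (seq letter) := fun w1 w2 => `[< pi1_rel w1 w2 >].

Lemma pi1_relb_equiv : equiv_class_of pi1_relb.
Proof.
split=> [w|w1 w2|w1 w2 w3].
- exact/asboolP/pi1_refl.
- by apply: asbool_equiv_eq; split; apply: pi1_sym.
- by move=> /asboolP h1 /asboolP h2; apply/asboolP/(pi1_trans h1 h2).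
Qed.

Canonical pi1_equiv_rel := EquivRelPack pi1_relb_equiv.

Definition pi1 : Type := {eq_quot pi1_relb}.

HB.instance Definition _ := Choice.on pi1.
HB.instance Definition _ := EqQuotient.on pi1.

Definition pi1_of (w : seq letter) : pi1 := \pi_pi1 w.

Lemma pi1_ofP w1 w2 : pi1_of w1 = pi1_of w2 <-> pi1_rel w1 w2.
Proof. by split=> [/eqquotP/asboolP|h]; last exact/eqquotP/asboolP. Qed.

Lemma pi1_reprP w : pi1_rel (repr (pi1_of w)) w.
Proof. by apply/pi1_ofP; rewrite /pi1_of reprK. Qed.

Definition inv_letter (l : letter) : letter :=
  match l with
  | inl g => vletter (tagged g)^-1
  | inr (e, b) => eletter e (~~ b)
  end.

Definition inv_word (w : seq letter) : seq letter := rev (map inv_letter w).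

Lemma pi1_mulV_letter l : pi1_rel [:: inv_letter l; l] [::].
Proof.
case: l => [[v g]|[e b]] /=.
  by apply: pi1_trans (pi1_mul _ _) _; rewrite mulVg; apply: pi1_one.
by rewrite -/(eletter e b) -{2}[b]negbK; apply: pi1_cancel.
Qed.

Lemma inv_letterK : involutive inv_letter.
Proof. by case=> [[v g]|[e b]]; rewrite /= ?invgK ?negbK. Qed.

Lemma inv_wordK : involutive inv_word.
Proof.
by move=> w; rewrite /inv_word map_rev revK -map_comp map_id_in // => l _ /=;
   rewrite inv_letterK.
Qed.

Lemma pi1_mulV_word w : pi1_rel (inv_word w ++ w) [::].
Proof.
elim: w => [|l w IHw]; first exact: pi1_refl.
rewrite /inv_word /= rev_cons -cats1 -catA /=.
apply: pi1_trans IHw; apply: pi1_cat (pi1_refl _) _.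
rewrite -(cat1s _ (l :: w)) -(cat1s l w) catA -[X in pi1_rel _ X]cat0s.
exact: pi1_cat (pi1_mulV_letter l) (pi1_refl _).
Qed.

Lemma pi1_mulwV_word w : pi1_rel (w ++ inv_word w) [::].
Proof. by rewrite -{1}[w]inv_wordK; apply: pi1_mulV_word. Qed.

Lemma pi1_inv_word w1 w2 :
  pi1_rel w1 w2 -> pi1_rel (inv_word w1) (inv_word w2).
Proof.
move=> h; have hl := pi1_mulwV_word w2; have hr := pi1_mulV_word w1.
apply: (@pi1_trans _ (inv_word w1 ++ (w2 ++ inv_word w2))).
  by rewrite -[X in pi1_rel X]cats0; apply: pi1_cat (pi1_refl _) (pi1_sym hl).
rewrite catA -[X in pi1_rel _ X]cat0s; apply: pi1_cat (pi1_refl _).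
apply: pi1_trans hr; exact: pi1_cat (pi1_refl _) (pi1_sym h).
Qed.

Definition pi1_unit : pi1 := pi1_of [::].
Definition pi1_prod (x y : pi1) : pi1 := pi1_of (repr x ++ repr y).
Definition pi1_inverse (x : pi1) : pi1 := pi1_of (inv_word (repr x)).

Lemma pi1_prodE w1 w2 : pi1_prod (pi1_of w1) (pi1_of w2) = pi1_of (w1 ++ w2).
Proof. by apply/pi1_ofP/pi1_cat; apply: pi1_reprP. Qed.

Lemma pi1_inverseE w : pi1_inverse (pi1_of w) = pi1_of (inv_word w).
Proof. by apply/pi1_ofP/pi1_inv_word/pi1_reprP. Qed.

Lemma pi1_prodA : associative pi1_prod.
Proof.
move=> x y z; rewrite -[x]reprK -[y]reprK -[z]reprK -!/(pi1_of _).
by rewrite !pi1_prodE catA.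
Qed.

Lemma pi1_prod1x : left_id pi1_unit pi1_prod.
Proof. by move=> x; rewrite -[x]reprK -/(pi1_of _) pi1_prodE. Qed.

Lemma pi1_prodx1 : right_id pi1_unit pi1_prod.
Proof. by move=> x; rewrite -[x]reprK -/(pi1_of _) pi1_prodE cats0. Qed.

Lemma pi1_prodVx : left_inverse pi1_unit pi1_inverse pi1_prod.
Proof.
move=> x; rewrite -[x]reprK -/(pi1_of _) pi1_inverseE pi1_prodE.
exact/pi1_ofP/pi1_mulV_word.
Qed.

Lemma pi1_prodxV : right_inverse pi1_unit pi1_inverse pi1_prod.
Proof.
move=> x; rewrite -[x]reprK -/(pi1_of _) pi1_inverseE pi1_prodE.
exact/pi1_ofP/pi1_mulwV_word.
Qed.

HB.instance Definition _ := isGroup.Build pi1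
  pi1_prodA pi1_prod1x pi1_prodx1 pi1_prodVx pi1_prodxV.

Definition vertex_in (v : vertex GG) (g : vgroup v) : pi1 :=
  pi1_of [:: vletter g].

Lemma vertex_inM v : {morph @vertex_in v : g h / g * h}.
Proof.
move=> g h; rewrite [RHS]pi1_prodE.
exact/pi1_ofP/pi1_sym/pi1_mul.
Qed.

HB.instance Definition _ v :=
  isMultiplicative.Build (vgroup v) pi1 (@vertex_in v) (@vertex_inM v).

End FundamentalGroup.

Definition remove_edge (GG : graph_of_groups) (e : edge GG) : graph_of_groups :=
  @GraphOfGroups (vertex GG) {f : edge GG | f != e}
    (fun f => endp (val f)) (fun f => endm (val f))
    (@vgroup GG) (fun f => egroup (val f))
    (fun f => phip (val f)) (fun f => phim (val f))
    (fun f => @phip_inj GG (val f)) (fun f => @phim_inj GG (val f)).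

Definition edge_inp (GG : graph_of_groups) (e : edge GG)
    (T : {set edge (remove_edge e)}) (a : egroup e) : pi1 T :=
  @vertex_in (remove_edge e) T (endp e) (phip e a).

Definition edge_inm (GG : graph_of_groups) (e : edge GG)
    (T : {set edge (remove_edge e)}) (a : egroup e) : pi1 T :=
  @vertex_in (remove_edge e) T (endm e) (phim e a).

(* Changing [T] conjugates the images of the vertex groups, so the condition
   does not depend on [T]. *)
Definition balanced (GG : graph_of_groups) (e : edge GG) : Prop :=
  connected_graph (remove_edge e) ->
  forall T : {set edge (remove_edge e)}, spanning_tree T ->
  forall a : egroup e, infinite_order a ->
  forall (h : pi1 T) (i j : int),
    h * expgz (edge_inp T a) i * h^-1 = expgz (edge_inm T a) j ->
    absz i = absz j.

Definition unbalanced (GG : graph_of_groups) (e : edge GG) : Prop :=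
  ~ balanced e.

(* Main.v *)
Require Import Defs.
From HB Require Import structures.
From mathcomp Require Import all_boot all_order all_algebra.
From mathcomp Require Import zify.
From mathcomp Require Import boolp classical_sets cardinality.

(** Write [F] for the multiple HNN extension of the direct product [B] of the
    vertex groups, with one stable letter per edge.  Van der Waerden's action of
    [F] on normal forms gives Britton-type lemmas, and [pi1 T] embeds in [F]:
    reading a normal form back along its path of edges inverts the embedding.

    If [a] is conjugate to no element of [B], a conjugate of [a] is cyclically
    reduced and the syllable length of [a^k] grows linearly up to conjugacy, so
    [s a^p s^-1 = a^q] forces [p = q].

    For elliptic elements, balancedness of all edges yields a weight [N > 0] on
    infinite-order elements of vertex groups, with [N (a^n) = n N a], invariant
    under conjugation and under every edge.  On a single vertex group it comes
    from the absence of distortion; edges are added one at a time, rescaling [N]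
    on one commensurability class, where two-endedness makes all infinite-order
    elements of an edge group commensurable.  Britton's lemma extends the
    invariance of [N] to conjugation in [F], so [p N a = q N a]. *)

Set Implicit Arguments.
Unset Strict Implicit.
Unset Printing Implicit Defensive.

Import Order.TTheory GRing.Theory Num.Theory.

Local Open Scope group_scope.

(** A single base group [B] keeps all coset representatives in one type. The price is that an
    element of [B] has a coordinate at every vertex: the weight on [B] is therefore a sum over
    coordinates, and reading back keeps only the coordinate at the current vertex of the path.

    Balancedness of [e] speaks only of conjugation in the complement of [e]. This is why edges are
    added one at a time: when [e] is added, all identifications made so far run along other edges
    and hold in that complement.

    For the converse, let [e] be unbalanced, with [h * a_+^i * h^-1 = a_-^j] in the group of the
    complement. That group maps to [pi1 T], where the stable letter [t] of [e] gives
    [a_- = t * a_+ * t^-1]. So [t^-1 * h], corrected for the change of spanning tree, conjugates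
    [a_+^i] to [a_+^j]. The element [a_+] keeps its infinite order because vertex groups embed in
    [pi1 T], which is again read off from [F]. *)

Section Morphisms.
Variables (G H : groupType) (f : G -> H).
Hypothesis fM : {morph f : x y / x * y}.

Lemma morph_mulg1 : f 1 = 1.
Proof. by apply: (mulgI (f 1)); rewrite -fM !mulg1. Qed.

Lemma morph_mulgV : {morph f : x / x^-1}.
Proof.
by move=> x; apply: (mulgI (f x)); rewrite -fM !mulgV morph_mulg1.
Qed.

Lemma morph_mulgX n : {morph f : x / x ^+ n}.
Proof.
move=> x; elim: n => [|n IHn]; first exact: morph_mulg1.
by rewrite !expgS fM IHn.
Qed.

Lemma morph_expgz i : {morph f : x / expgz x i}.
Proof. by case: i => n x /=; rewrite ?morph_mulgV morph_mulgX. Qed.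

End Morphisms.

Section GroupLemmas.
Variable G : groupType.
Implicit Types (a b s x y : G) (i j : int).

Lemma conj_morph y : {morph (fun x => y * x * y^-1) : a b / a * b}.
Proof. by move=> a b; rewrite /= !mulgA mulgVK. Qed.

Lemma conj_expg y x n : y * x ^+ n * y^-1 = (y * x * y^-1) ^+ n.
Proof. exact: (morph_mulgX (conj_morph y)). Qed.

Lemma conj_expgz y x i : y * expgz x i * y^-1 = expgz (y * x * y^-1) i.
Proof. exact: (morph_expgz (conj_morph y)). Qed.

Lemma conj_invg y x : y * x^-1 * y^-1 = (y * x * y^-1)^-1.
Proof. by rewrite !invgM invgK mulgA. Qed.

Lemma conjg_mulP s x y : s * x * s^-1 = y <-> s * x = y * s.
Proof. by split=> [<-|->]; rewrite ?mulgVK ?mulgK. Qed.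

Lemma expgz_abs x i : expgz x i = x ^+ absz i \/ expgz x i = (x ^+ absz i)^-1.
Proof. by case: i => n; [left|right]. Qed.

(* The ratio survives squaring [s], which makes the signs of the exponents
   agree; replacing [s] by its inverse then orders them. *)
Lemma almost_BS_nat a s i j :
  infinite_order a -> i <> 0%R -> j <> 0%R -> absz i <> absz j ->
  s * expgz a i * s^-1 = expgz a j ->
  exists s' (p q : nat), [/\ (0 < p)%N, (p < q)%N, s' * a ^+ p * s'^-1 = a ^+ q &
    forall n, s ^+ n = 1 -> s' ^+ n = 1].
Proof.
move=> ainf i0 j0 ij rel.
have ip : (0 < absz i)%N by rewrite absz_gt0; apply/eqP.
have jp : (0 < absz j)%N by rewrite absz_gt0; apply/eqP.
(* The clause on powers of [s] is what later shows, in [almost_BS_of_rel], that [s] has infinite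
   order. *)
suff [s' [p [q [[p0 q0] pq rel' s1]]]] : exists s' (p q : nat),
    [/\ (0 < p)%N /\ (0 < q)%N, p <> q, s' * a ^+ p * s'^-1 = a ^+ q &
        forall n, s ^+ n = 1 -> s' ^+ n = 1].
  have [lt_pq|lt_qp|//] := ltngtP p q; first by exists s', p, q.
  exists s'^-1, q, p; split=> // [|n /s1 e]; last by rewrite expVgn e invg1.
  by rewrite -rel' invgK !mulgA mulVg mul1g mulgVK.
have sgn : s * a ^+ absz i * s^-1 = a ^+ absz j \/
           s * a ^+ absz i * s^-1 = (a ^+ absz j)^-1.
  move: rel; case: (expgz_abs a i) => ->; case: (expgz_abs a j) => ->;
    rewrite ?conj_invg; do ?[by left|by right].
    by move/(congr1 (fun x : G => x^-1)); rewrite invgK; right.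
  by move/invg_inj; left.
case: sgn => {}rel; first by exists s, (absz i), (absz j).
exists (s * s), (absz i * absz i)%N, (absz j * absz j)%N.
split; first by rewrite !muln_gt0 ip jp.
- by move/eqP; rewrite !mulnn eqn_exp2r // => /eqP.
- have -> x : s * s * x / (s * s) = s * (s * x / s) / s by rewrite invgM !mulgA.
  rewrite expgnA conj_expg rel.
  by rewrite expVgn conj_invg expgnAC conj_expg rel expVgn invgK -expgnA.
- by move=> n e; rewrite expgMn // e mulg1.
Qed.

End GroupLemmas.

(** * Trees and fundamental groups *)

Section Connectivity.
Variable GG : graph_of_groups.
Implicit Types (A T : {set edge GG}) (u v w : vertex GG).

Lemma adj_sym A : symmetric (adj A).
Proof.
by move=> u v; apply: eq_existsb => e; rewrite orbC.
Qed.

Lemma connect_adj_sym A : connect_sym (adj A).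
Proof. exact/sym_connect_sym/adj_sym. Qed.

Lemma adjP A u v :
  reflect (exists2 e, e \in A &
            u = endp e /\ v = endm e \/ u = endm e /\ v = endp e)
          (adj A u v).
Proof.
apply: (iffP existsP) => -[e].
  case/andP=> eA /orP[] /andP[/eqP<- /eqP<-]; exists e => //; first by left.
  by right.
by move=> eA h; exists e; rewrite eA; case: h => -[-> ->]; rewrite !eqxx ?orbT.
Qed.

Lemma connect_edge A e : e \in A -> connect (adj A) (endp e) (endm e).
Proof. by move=> eA; apply/connect1/adjP; exists e => //; left. Qed.

Lemma connect_adjS A A' u v :
  A \subset A' -> connect (adj A) u v -> connect (adj A') u v.
Proof.
move=> sAA'; apply: connect_sub => {u v} u v /adjP[e eA h].
by apply/connect1/adjP; exists e; rewrite ?(fintype.subsetP sAA').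
Qed.

Lemma connect_adjD1 A e u v :
  connect (adj (A :\ e)%SET) (endp e) (endm e) ->
  connect (adj A) u v -> connect (adj (A :\ e)%SET) u v.
Proof.
move=> he; apply: connect_sub => {u v} u v /adjP[f fA h].
case: (eqVneq f e) h => [->|nfe] h.
  by case: h => -[-> ->] //; rewrite connect_adj_sym.
by apply/connect1/adjP; exists f => //; rewrite !inE nfe.
Qed.

(** A connecting edge set of least size is a tree: by [connect_adjD1], an edge closing a cycle could
    be dropped. *)
Lemma spanning_tree_exists : connected_graph GG -> exists T, spanning_tree T.
Proof.
case=> n0 conn.
pose P A := [forall u, forall v, connect (adj A) u v].
have PT : P [set: edge GG]%SET by apply/forallP=> u; apply/forallP.
case: (@arg_minnP _ [set: edge GG]%SET P (fun A => #|A|) PT) => T TP Tmin.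
exists T; split.
  by split=> // u v; apply/forallP: v; apply/forallP: u.
move=> e eT; apply/negP => he.
have : P (T :\ e)%SET.
  apply/forallP=> u; apply/forallP=> v; apply: connect_adjD1 he _.
  by apply/forallP: v; apply/forallP: u.
by move/Tmin; rewrite (cardsD1 e T) eT ltnn.
Qed.

Lemma acyclicS A A' : A \subset A' -> acyclic A' -> acyclic A.
Proof.
move=> sAA' acA' e eA; apply: contra (acA' e (fintype.subsetP sAA' e eA)).
exact/connect_adjS/finset.setSD.
Qed.

(** Over a forest every edge labelling is a coboundary: the edge equations survive left
    multiplication of [gam] by a constant on a whole component, so they can be repaired one edge at
    a time. *)
Lemma acyclic_potential (K : groupType) (c : edge GG -> K) A :
  acyclic A ->
  exists gam : vertex GG -> K,
    forall e, e \in A -> gam (endm e) * c e = gam (endp e).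
Proof.
have [n] := ubnPleq #|A|; elim: n A => [|n IHn] A leA acA.
  exists (fun=> 1) => e; move: leA; rewrite leqn0 cards_eq0 => /eqP->.
  by rewrite inE.
have [->|[e eA]] := set_0Vmem A; first by exists (fun=> 1) => e; rewrite inE.
have sA : (A :\ e)%SET \subset A by apply: finset.subsetDl.
have [|gam gamP] := IHn (A :\ e)%SET _ (acyclicS sA acA).
  by rewrite -ltnS; apply: leq_trans leA; rewrite [in leqRHS](cardsD1 e A) eA.
(* Without [e] its two ends lie in different components. Multiplying by [x] on the component of
   [endp e] repairs the equation at [e] and keeps all others. *)
pose x := gam (endm e) * c e * (gam (endp e))^-1.
pose C := connect (adj (A :\ e)%SET) (endp e).
exists (fun v => if C v then x * gam v else gam v) => f fA.
have [->|nfe] := eqVneq f e.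
  rewrite /C connect0 (negPf (acA e eA)) /x -!mulgA mulVg mulg1 //.
have fA' : f \in (A :\ e)%SET by rewrite !inE nfe.
have -> : C (endm f) = C (endp f).
  apply/idP/idP => h; apply: connect_trans h _; last exact: connect_edge.
  by rewrite connect_adj_sym; apply: connect_edge.
by case: (C _); rewrite -?mulgA gamP.
Qed.

End Connectivity.

(** * Universal property of the fundamental group *)

Section Lift.
Variables (GG : graph_of_groups) (T : {set edge GG}).

Definition stable_letter (e : edge GG) : pi1 T := pi1_of T [:: eletter e true].

Lemma vertex_in1 v : vertex_in T (1 : vgroup v) = 1.
Proof. exact: (morph_mulg1 (@vertex_inM GG T v)). Qed.

Lemma pi1_ofM w1 w2 : pi1_of T (w1 ++ w2) = pi1_of T w1 * pi1_of T w2.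
Proof. by rewrite -pi1_prodE. Qed.

Lemma stable_letterV e : pi1_of T [:: eletter e false] = (stable_letter e)^-1.
Proof. by rewrite -[RHS]/(pi1_inverse _) pi1_inverseE. Qed.

Lemma stable_letter_rel e (c : egroup e) :
  stable_letter e * vertex_in T (phip e c) = vertex_in T (phim e c) * stable_letter e.
Proof.
apply/conjg_mulP; rewrite -stable_letterV /vertex_in /stable_letter.
rewrite -(pi1_ofM [:: eletter e true]) -pi1_ofM.
exact/pi1_ofP/pi1_edge.
Qed.

Lemma stable_letter_tree e : e \in T -> stable_letter e = 1.
Proof. by move=> eT; apply/pi1_ofP/pi1_tree. Qed.

Lemma pi1_gen_ind (P : pi1 T -> Prop) :
    P 1 -> (forall v (g : vgroup v) x, P x -> P (vertex_in T g * x)) ->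
    (forall e x, P x -> P (stable_letter e * x)) ->
    (forall e x, P x -> P ((stable_letter e)^-1 * x)) ->
  forall x, P x.
Proof.
move=> P1 Pv Pt PtV x; rewrite -[x]reprK; elim: (repr x) => // l w IHw.
rewrite -cat1s -/(pi1_of T _) pi1_ofM.
case: l => [[v g]|[e []]]; [exact: Pv|exact: Pt|].
by rewrite -/(eletter e false) stable_letterV; apply: PtV.
Qed.

Variables (K : groupType) (iota : forall v : vertex GG, vgroup v -> K) (tau : edge GG -> K).
Hypotheses (iotaM : forall v, {morph @iota v : g h / g * h})
  (tau_rel : forall e (c : egroup e),
     tau e * @iota _ (phip e c) = @iota _ (phim e c) * tau e)
  (tau_tree : forall e, e \in T -> tau e = 1).

Definition letter_val (l : letter GG) : K :=
  match l with
  | inl p => iota (tagged p)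
  | inr (e, b) => if b then tau e else (tau e)^-1
  end.

Definition word_val (w : seq (letter GG)) : K := \prod_(l <- w) letter_val l.

Lemma word_val_rel w1 w2 : pi1_rel T w1 w2 -> word_val w1 = word_val w2.
Proof.
elim=> {w1 w2} [v|v g h|e b|e c|e eT||w1 w2 _ <-|w1 w2 w3 _ -> _ ->|w1 w2 w3 w4 _ h1 _ h2] //;
  rewrite /word_val ?big_cat ?big_cons ?big_nil /= ?mulg1.
- exact: (morph_mulg1 (@iotaM v)).
- by rewrite iotaM.
- by case: b; rewrite /= ?mulgV ?mulVg.
- by rewrite mulgA tau_rel mulgK.
- exact: tau_tree.
- by rewrite -!/(word_val _) h1 h2.
Qed.

Definition pi1_lift (x : pi1 T) : K := word_val (repr x).

Lemma pi1_liftE w : pi1_lift (pi1_of T w) = word_val w.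
Proof. exact/word_val_rel/pi1_reprP. Qed.

Lemma pi1_liftM : {morph pi1_lift : x y / x * y}.
Proof.
move=> x y; rewrite -[x]reprK -[y]reprK -!/(pi1_of T _) -pi1_ofM !pi1_liftE.
exact: big_cat.
Qed.

Lemma pi1_lift_vertex v (g : vgroup v) : pi1_lift (vertex_in T g) = iota g.
Proof. by rewrite pi1_liftE /word_val big_seq1. Qed.

Lemma pi1_lift_stable e : pi1_lift (stable_letter e) = tau e.
Proof. by rewrite pi1_liftE /word_val big_seq1. Qed.

End Lift.

(** * Multiple HNN extensions *)

Section NormalForms.
Variables (B : groupType) (E : finType) (A : E -> groupType).
Variables (fp fm : forall e : E, {multiplicative A e -> B}).
Hypotheses (fp_inj : forall e, injective (fp e)) (fm_inj : forall e, injective (fm e)).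

(* The direction [(e, true)] is the stable letter [t_e], with
   [t_e * fp e c = fm e c * t_e], and [(e, false)] is its inverse. *)
Definition dir : Type := (E * bool)%type.
HB.instance Definition _ := Choice.on dir.
Implicit Types (d : dir) (b g r : B).

Definition revd d : dir := (d.1, ~~ d.2).
Definition src d (c : A d.1) : B := if d.2 then fm d.1 c else fp d.1 c.
Definition tgt d (c : A d.1) : B := if d.2 then fp d.1 c else fm d.1 c.

Lemma revdK : involutive revd.
Proof. by case=> e b; rewrite /revd negbK. Qed.

Lemma revd_neq d : revd d != d.
Proof. by case: d => e []; rewrite /revd xpair_eqE andbF. Qed.

Lemma src_revd d (c : A d.1) : src (d := revd d) c = tgt c.
Proof. by case: d c => e []. Qed.

Lemma tgt_revd d (c : A d.1) : tgt (d := revd d) c = src c.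
Proof. by case: d c => e []. Qed.

Lemma srcM d : {morph @src d : x y / x * y}.
Proof. by case: d => e [] x y; rewrite /src /= gmulfM. Qed.

Lemma tgtM d : {morph @tgt d : x y / x * y}.
Proof. by case: d => e [] x y; rewrite /tgt /= gmulfM. Qed.

Lemma src_inj d : injective (@src d).
Proof. by case: d => e [] x y h; [apply: fm_inj h|apply: fp_inj h]. Qed.

Definition in_src d b : Prop := exists c : A d.1, b = src c.

(* A transversal of the left cosets of the image of [src], with [1] chosen in
   the trivial coset, and the corresponding cofactor. *)
Definition coset_rep d b : B :=
  if `[< in_src d b >] then 1
  else xget 1 [set y | exists c : A d.1, b = y * src c]%classic.

Definition cofactor d b : A d.1 := xget 1 [set c | b = coset_rep d b * src c]%classic.

Lemma coset_repE d b : b = coset_rep d b * src (cofactor d b).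
Proof.
suff [c hc] : exists c : A d.1, b = coset_rep d b * src c.
  exact: (@xgetPex _ 1 [set c | b = coset_rep d b * src c]%classic) (ex_intro _ c hc).
rewrite /coset_rep; case: asboolP => [[c ->]|_]; first by exists c; rewrite mul1g.
apply: (@xgetPex _ 1 [set y | exists c : A d.1, b = y * src c]%classic).
by exists b, 1; rewrite (morph_mulg1 (@srcM d)) mulg1.
Qed.

Lemma coset_rep_src d b (c : A d.1) : coset_rep d (b * src c) = coset_rep d b.
Proof.
rewrite /coset_rep; have -> : in_src d (b * src c) = in_src d b.
  apply/propext; split=> -[x hx]; last by exists (x * c); rewrite hx srcM.
  exists (x * c^-1).
  by rewrite srcM -hx (morph_mulgV (@srcM d)) mulgK.
case: asboolP => // _; congr (xget _ _); apply/seteqP; split=> y /= [x hx].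
  exists (x * c^-1).
  by rewrite srcM mulgA -hx (morph_mulgV (@srcM d)) mulgK.
by exists (x * c); rewrite hx srcM mulgA.
Qed.

(** Injectivity of the edge maps enters here: it makes the factorization through the transversal
    unique. *)
Lemma cofactor_uniq d b r (c : A d.1) :
  coset_rep d b = r -> b = r * src c -> cofactor d b = c.
Proof.
by move=> <- h; apply: (@src_inj d); apply: (mulgI (coset_rep d b));
   rewrite -h -coset_repE.
Qed.

Lemma coset_repK d b : coset_rep d (coset_rep d b) = coset_rep d b.
Proof. by rewrite [in RHS](coset_repE d b) coset_rep_src. Qed.

Lemma coset_rep1 d : coset_rep d 1 = 1.
Proof.
rewrite /coset_rep; case: asboolP => // -[]; exists 1.
by rewrite (morph_mulg1 (@srcM d)).
Qed.

Lemma coset_rep_in d (c : A d.1) : coset_rep d (src c) = 1.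
Proof. by rewrite -[src c]mul1g coset_rep_src coset_rep1. Qed.

Lemma coset_rep_eq1 d b : coset_rep d b = 1 -> in_src d b.
Proof. by move=> h; exists (cofactor d b); rewrite {1}(coset_repE d b) h mul1g. Qed.

(* [([:: (d1, r1); ...; (dn, rn)], g)] stands for [r1 * d1 * ... * rn * dn * g]. *)
Definition nform : Type := (seq (dir * B) * B)%type.
Implicit Types (L : seq (dir * B)) (x : nform).

(** A representative lies in the edge subgroup only if it is [1], so this excludes exactly the
    pinches of Britton's lemma. *)
Definition head_ok d L : bool :=
  if L is (d', r) :: _ then ~~ ((d' == revd d) && (r == 1)) else true.

Fixpoint reduced L : bool :=
  if L is (d, r) :: L' then
    [&& coset_rep d r == r, head_ok d L' & reduced L'] else true.

(** The factor [b] is pushed to the right: if [b * r = r' * src c], then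
    [b * r * d = r' * d * tgt c], and [tgt c] continues into the tail. *)
Fixpoint bact_seq b L g : nform :=
  if L is (d, r) :: L' then
    let y := bact_seq (tgt (cofactor d (b * r))) L' g in
    ((d, coset_rep d (b * r)) :: y.1, y.2)
  else ([::], b * g).

Definition bact b x : nform := bact_seq b x.1 x.2.

Definition tact d x : nform :=
  if x.1 is (d', r) :: L' then
    if (d' == revd d) && (r == 1) then (L', x.2) else ((d, 1) :: x.1, x.2)
  else ([:: (d, 1)], x.2).

Lemma bact_cons b d r L g :
  let y := bact (tgt (cofactor d (b * r))) (L, g) in
  bact b ((d, r) :: L, g) = ((d, coset_rep d (b * r)) :: y.1, y.2).
Proof. by []. Qed.

Lemma tact_push d x : head_ok d x.1 -> tact d x = ((d, 1) :: x.1, x.2).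
Proof. by case: x => -[|[d' r] L] g //=; rewrite /tact /= => /negPf->. Qed.

Lemma tact_pop d L g : tact d ((revd d, 1) :: L, g) = (L, g).
Proof. by rewrite /tact /= !eqxx. Qed.

Lemma bact1 x : reduced x.1 -> bact 1 x = x.
Proof.
case: x => L g /=; elim: L => [|[d r] L IHL]; first by rewrite /bact /= mul1g.
move=> /= /and3P[/eqP hr _ hL]; rewrite bact_cons mul1g hr.
rewrite (@cofactor_uniq d r r 1) ?(morph_mulg1 (@srcM d)) ?mulg1 //.
by rewrite (morph_mulg1 (@tgtM d)) IHL.
Qed.

Lemma bactM b b' x : bact (b * b') x = bact b (bact b' x).
Proof.
case: x => L g; elim: L b b' => [|[d r] L IHL] b b'; first by rewrite /bact /= mulgA.
have e : b * b' * r = b * coset_rep d (b' * r) * src (cofactor d (b' * r)).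
  by rewrite -!mulgA -coset_repE.
have ec : cofactor d (b * b' * r) =
    cofactor d (b * coset_rep d (b' * r)) * cofactor d (b' * r).
  apply: (@cofactor_uniq _ _ (coset_rep d (b * coset_rep d (b' * r)))).
    by rewrite e coset_rep_src.
  by rewrite srcM mulgA -coset_repE.
rewrite !bact_cons ec tgtM IHL -surjective_pairing.
by rewrite {1}e coset_rep_src.
Qed.

(** Multiplication by [tgt c] stays in the coset of the edge subgroup of [revd d], so a pinch after
    it would have been a pinch before. *)
Lemma head_ok_bact d (c : A d.1) L g :
  reduced L -> head_ok d L -> head_ok d (bact (tgt c) (L, g)).1.
Proof.
case: L => // -[d' r] L /= /and3P[/eqP hr _ _]; apply: contra.
case/andP=> /eqP ed /eqP h; rewrite ed eqxx /=; subst d'.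
have [c' hc'] := coset_rep_eq1 h.
rewrite -hr -(coset_rep_in (d := revd d) (c^-1 * c')) srcM.
by rewrite (morph_mulgV (@srcM (revd d))) -hc' src_revd mulKg.
Qed.

Lemma reduced_bact b x : reduced x.1 -> reduced (bact b x).1.
Proof.
case: x => L g; elim: L b => [|[d r] L IHL] b //= /and3P[_ hd hL].
by rewrite coset_repK eqxx head_ok_bact //=; apply: (IHL _ hL).
Qed.

Lemma reduced_tact d x : reduced x.1 -> reduced (tact d x).1.
Proof.
case: x => -[|[d' r] L] g; rewrite /tact /=; first by rewrite coset_rep1 eqxx.
case: ifP => h /= /and3P[hr hd hL] //.
by rewrite coset_rep1 eqxx h hr hd hL.
Qed.

Lemma tactK d x : reduced x.1 -> tact d (tact (revd d) x) = x.
Proof.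
case: x => -[|[d' r] L] g; first by rewrite {2}/tact /= tact_pop.
rewrite {2}/tact /=; case: ifP => [/andP[/eqP-> /eqP->]|_ _]; last exact: tact_pop.
by case/and3P=> _; rewrite revdK => hd _; rewrite tact_push.
Qed.

(** This is the defining relation of the stable letters, checked on normal forms according to
    whether [d] is pushed or cancels the first letter. *)
Lemma tact_bact d (c : A d.1) x : reduced x.1 ->
  tact d (bact (tgt c) x) = bact (src c) (tact d x).
Proof.
case: x => L g rL; case: (boolP (head_ok d L)) => [hd|].
  rewrite !tact_push ?head_ok_bact // bact_cons mulg1 coset_rep_in.
  by rewrite (@cofactor_uniq _ _ 1 c) ?mul1g ?coset_rep_in.
case: L rL => // -[d' r] L _ /=; rewrite negbK => /andP[/eqP-> /eqP->].
rewrite bact_cons tact_pop mulg1 -src_revd coset_rep_in tact_pop.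
rewrite (@cofactor_uniq (revd d) _ 1 c) ?mul1g ?(coset_rep_in (d := revd d)) //.
by rewrite tgt_revd; case: bact.
Qed.

End NormalForms.

(** * The action on normal forms and Britton-type lemmas *)

Section HNN.
Variables (B : groupType) (E : finType) (A : E -> groupType).
Variables (fp fm : forall e : E, {multiplicative A e -> B}).
Hypotheses (fp_inj : forall e, injective (fp e)) (fm_inj : forall e, injective (fm e)).

Local Notation dir := (dir E).
Local Notation nform := (nform B E).
Local Notation src := (src fp fm).
Local Notation tgt := (tgt fp fm).
Local Notation reduced := (reduced fp fm).
Local Notation bact := (bact fp fm).
Local Notation coset_rep := (coset_rep fp fm).
Local Notation cofactor := (cofactor fp fm).
Implicit Types (d : dir) (b g r : B) (L : seq (dir * B)) (x : nform).

(** The extension is encoded as the fundamental group of a one-vertex graph with empty tree, so that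
    group structure, induction and relations come from [pi1]. *)
Definition hnn_graph : graph_of_groups :=
  @GraphOfGroups unit E (fun=> tt) (fun=> tt) (fun=> B) A fp fm fp_inj fm_inj.

Definition hnn : groupType := pi1 (GG := hnn_graph) finset.set0.

Definition base_in b : hnn := @vertex_in hnn_graph finset.set0 tt b.

Definition dir_letter (K : groupType) (tau : E -> K) d : K :=
  if d.2 then tau d.1 else (tau d.1)^-1.

Definition stable d : hnn := dir_letter (@stable_letter hnn_graph finset.set0) d.

Lemma base_inM : {morph base_in : x y / x * y}.
Proof. exact: (@vertex_inM hnn_graph finset.set0 tt). Qed.

Lemma dir_letter_revd (K : groupType) (tau : E -> K) d :
  dir_letter tau (revd d) = (dir_letter tau d)^-1.
Proof. by case: d => e []; rewrite /dir_letter /= ?invgK. Qed.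

(** The map [i] may depend on the end of the edge: [base_in] is the constant case, while reading
    back into [pi1 T] uses different coordinates at the two ends. *)
Lemma dir_letter_rel (K : groupType) (i : bool -> E -> B -> K) (tau : E -> K) :
    (forall e c, tau e * i true e (fp e c) = i false e (fm e c) * tau e) ->
  forall d (c : A d.1),
    dir_letter tau d * i d.2 d.1 (tgt c) = i (~~ d.2) d.1 (src c) * dir_letter tau d.
Proof.
move=> rel [e []] c; rewrite /dir_letter /= ?rel //.
by apply: (mulgI (tau e)); rewrite mulVKg mulgA rel mulgK.
Qed.

Lemma stable_rel d (c : A d.1) : stable d * base_in (tgt c) = base_in (src c) * stable d.
Proof.
apply: (@dir_letter_rel hnn (fun _ _ => base_in)) => e c'.
exact: (@stable_letter_rel hnn_graph).
Qed.

Lemma stable_revd d : stable (revd d) = (stable d)^-1.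
Proof. exact: dir_letter_revd. Qed.

Lemma hnn_ind (P : hnn -> Prop) :
    P 1 -> (forall b f, P f -> P (base_in b * f)) ->
    (forall d f, P f -> P (stable d * f)) ->
  forall f, P f.
Proof.
move=> P1 Pb Pd; apply: pi1_gen_ind => // [[] g f|e f|e f]; first exact: Pb.
  exact: (Pd (e, true)).
exact: (Pd (e, false)).
Qed.

Definition letter_act (l : letter hnn_graph) x : nform :=
  match l with
  | inl p => bact (tagged p) x
  | inr d => tact d x
  end.

Definition word_act (w : seq (letter hnn_graph)) x : nform := foldr letter_act x w.

Lemma reduced_word_act w x : reduced x.1 -> reduced (word_act w x).1.
Proof.
by elim: w => //= -[[v b]|d] w IHw hx; rewrite /= ?reduced_bact ?reduced_tact ?IHw.
Qed.

(** Reducedness cannot be dropped: on other forms [1] may replace a representative, and a cancelling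
    pair of stable letters may remove a pinch. *)
Lemma word_act_rel w1 w2 : pi1_rel finset.set0 w1 w2 ->
  forall x, reduced x.1 -> word_act w1 x = word_act w2 x.
Proof.
elim=> {w1 w2} [v|v g h|e b|e c|e eT|w|w1 w2 _ IH|w1 w2 w3 _ IH1 _ IH2|w1 w2 w3 w4 _ IH1 _ IH2] x hx //=.
- exact: bact1.
- by rewrite bactM.
- by rewrite -[(e, ~~ b)]/(revd (e, b)) (@tactK _ _ _ fp fm).
- rewrite -[fp e c]/(tgt (d := (e, true)) c).
  rewrite tact_bact ?reduced_tact // -[(e, false)]/(revd (e, true)) (@tactK _ _ _ fp fm) //.
- by move: eT; rewrite inE.
- by rewrite IH.
- by rewrite IH1 // IH2.
- rewrite /word_act !foldr_cat -!/(word_act _ _) IH2 // IH1 //.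
  exact: reduced_word_act.
Qed.

Definition act (f : hnn) x : nform := word_act (repr f) x.

Lemma act_pi1_of w x : reduced x.1 -> act (pi1_of finset.set0 w) x = word_act w x.
Proof. by apply: word_act_rel; apply: pi1_reprP. Qed.

Lemma reduced_act f x : reduced x.1 -> reduced (act f x).1.
Proof. exact: reduced_word_act. Qed.

Lemma actM f f' x : reduced x.1 -> act (f * f') x = act f (act f' x).
Proof.
move=> hx; rewrite -[f]reprK -[f']reprK -!/(pi1_of _ _) -pi1_ofM !act_pi1_of //.
  by rewrite /word_act foldr_cat.
exact: reduced_word_act.
Qed.

Lemma act1 x : reduced x.1 -> act 1 x = x.
Proof. exact: (@act_pi1_of [::]). Qed.

Lemma act_base b x : reduced x.1 -> act (base_in b) x = bact b x.
Proof. exact: (@act_pi1_of [:: inl (existT _ tt b)]). Qed.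

Lemma act_stable d x : reduced x.1 -> act (stable d) x = tact d x.
Proof.
move=> hx; case: d => e []; first exact: (@act_pi1_of [:: eletter (GG := hnn_graph) e true]).
rewrite /stable /dir_letter /= -stable_letterV.
exact: (@act_pi1_of [:: eletter (GG := hnn_graph) e false]).
Qed.

Definition rmul b x : nform := (x.1, x.2 * b).

Lemma bact_rmul b b' x : bact b (rmul b' x) = rmul b' (bact b x).
Proof.
case: x => L g; elim: L b => [|[d r] L IHL] b; first by rewrite /bact /rmul /= mulgA.
by rewrite [rmul _ _]/= !bact_cons [(L, g * b')]/(rmul b' (L, g)) IHL.
Qed.

Lemma tact_rmul d b' x : tact d (rmul b' x) = rmul b' (tact d x).
Proof. by case: x => -[|[d' r] L] g; rewrite /tact //=; case: ifP. Qed.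

(** Letters act from the left and never inspect the final factor. Hence the form of [s * b] is known
    from that of [s]. *)
Lemma act_rmul f b x : reduced x.1 -> act f (rmul b x) = rmul b (act f x).
Proof.
move=> hx; elim/hnn_ind: f => [|b' f IHf|d f IHf]; first by rewrite !act1.
  by rewrite !actM // IHf !act_base ?bact_rmul ?reduced_act.
by rewrite !actM // IHf !act_stable ?tact_rmul ?reduced_act.
Qed.

Definition origin : nform := ([::], 1).

Lemma base_in_inj : injective base_in.
Proof.
by move=> b b' /(congr1 (act^~ origin)); rewrite !act_base // /bact /= !mulg1 => -[].
Qed.

(* Paths are only recorded through their labels in [V]: [org d] and
   [org (revd d)] are the ends of [d], while coset representatives are arbitrary
   elements of [B], projected to [K] by the map attached to the current label. *)
Section Readback.
Variables (V : Type) (K : groupType) (org : dir -> V) (v0 : V).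
Variables (iota : V -> B -> K) (tau : dir -> K).
Hypotheses (iotaM : forall v, {morph iota v : x y / x * y})
  (tau_revd : forall d, tau (revd d) = (tau d)^-1)
  (tau_rel : forall d (c : A d.1),
     tau d * iota (org (revd d)) (tgt c) = iota (org d) (src c) * tau d).

Fixpoint path_from v L : Prop :=
  if L is (d, _) :: L' then org d = v /\ path_from (org (revd d)) L' else v = v0.

Fixpoint readback_seq L g : K :=
  if L is (d, r) :: L' then iota (org d) r * tau d * readback_seq L' g
  else iota v0 g.

Definition readback x : K := readback_seq x.1 x.2.

Lemma readback_bact v b x : path_from v x.1 ->
  path_from v (bact b x).1 /\ readback (bact b x) = iota v b * readback x.
Proof.
case: x => L g; elim: L v b => [|[d r] L IHL] v b.
  by move=> /= ->; rewrite /readback /= iotaM.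
case=> <- hL; rewrite bact_cons.
have [] := IHL _ (tgt (cofactor d (b * r))) hL.
case: (bact _ _) => L' g' /= hL' e; split=> //.
rewrite /readback /= in e *; rewrite e !mulgA -(mulgA _ (tau d) (iota _ (tgt _))) tau_rel.
by rewrite -!mulgA (mulgA (iota _ _)) -iotaM -coset_repE iotaM !mulgA.
Qed.

Lemma readback_tact d x : path_from (org (revd d)) x.1 ->
  path_from (org d) (tact d x).1 /\ readback (tact d x) = tau d * readback x.
Proof.
have i1 v : iota v 1 = 1 by apply: morph_mulg1.
case: x => -[|[d' r] L] g; rewrite /tact /readback /=.
  by move=> ->; rewrite i1 mul1g.
case: ifP => [/andP[/eqP-> /eqP->]|_ [h1 h2]] /=; last by rewrite i1 mul1g.
by case=> _; rewrite revdK => h; split=> //; rewrite i1 mul1g tau_revd mulVKg.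
Qed.

End Readback.

Definition readback_hnn : nform -> hnn :=
  @readback unit hnn (fun=> tt) tt (fun=> base_in) stable.

Lemma readback_act f x : reduced x.1 -> readback_hnn (act f x) = f * readback_hnn x.
Proof.
have pok L : path_from (fun=> tt) tt tt L by elim: L => // -[].
move=> hx; elim/hnn_ind: f => [|b f IHf|d f IHf]; first by rewrite act1 ?mul1g.
  rewrite actM // act_base ?reduced_act // -mulgA -IHf.
  by have [] := @readback_bact unit hnn (fun=> tt) tt (fun=> base_in) stable
    (fun=> base_inM) stable_rel tt b (act f x) (pok _).
rewrite actM // act_stable ?reduced_act // -mulgA -IHf.
by have [] := @readback_tact unit hnn (fun=> tt) tt (fun=> base_in) stable
  (fun=> base_inM) stable_revd d (act f x) (pok _).
Qed.

Definition seq_val L : hnn := \prod_(p <- L) (base_in p.2 * stable p.1).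

Lemma readback_hnnE L g : readback_hnn (L, g) = seq_val L * base_in g.
Proof.
rewrite /readback_hnn /readback /= /seq_val; elim: L => [|[d r] L IHL] /=.
  by rewrite big_nil mul1g.
by rewrite big_cons IHL !mulgA.
Qed.

Lemma normal_form f :
  f = seq_val (act f origin).1 * base_in (act f origin).2.
Proof.
rewrite -readback_hnnE -surjective_pairing readback_act // readback_hnnE.
by rewrite /seq_val big_nil (morph_mulg1 base_inM) !mulg1.
Qed.

(** In a reduced concatenation every stable letter is pushed and every representative represents
    itself, so nothing cancels. *)
Lemma act_seq_val L x : reduced (L ++ x.1) -> reduced x.1 ->
  act (seq_val L) x = (L ++ x.1, x.2).
Proof.
move=> + hx; rewrite /seq_val; elim: L => [|[d r] L IHL] /=.
  by rewrite big_nil act1 // -surjective_pairing.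
case/and3P=> /eqP hr hd hL; rewrite big_cons !actM // ?act1 //=.
rewrite IHL // act_stable // tact_push // act_base /=; last first.
  by rewrite coset_rep1 // eqxx hd hL.
rewrite bact_cons mulg1 hr (@cofactor_uniq _ _ _ _ _ _ _ _ _ r 1) //.
  by rewrite (morph_mulg1 (@tgtM _ _ _ _ _ d)) bact1.
by rewrite (morph_mulg1 (@srcM _ _ _ _ _ d)) mulg1.
exact: reduced_act.
Qed.

Lemma size_bact b x : size (bact b x).1 = size x.1.
Proof.
by case: x => L g; elim: L b => [|[d r] L IHL] b //=; rewrite -(IHL (tgt (cofactor d (b * r)))).
Qed.

Lemma size_tact d x : (size (tact d x).1 <= (size x.1).+1)%N.
Proof.
case: x => -[|[d' r] L] g; rewrite /tact //=; case: ifP => //= _.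
by rewrite leqW.
Qed.

Lemma size_act_seq_val L g x : reduced x.1 ->
  (size (act (seq_val L * base_in g) x).1 <= size L + size x.1)%N.
Proof.
move=> hx; rewrite actM // act_base //.
rewrite -(size_bact g x); have: reduced (bact g x).1 by apply: reduced_bact.
move: (bact g x) => {hx}x hx; rewrite /seq_val.
elim: L => [|[d r] L IHL]; first by rewrite big_nil act1.
rewrite big_cons !actM // ?reduced_act // act_base ?size_bact ?reduced_act //.
rewrite act_stable ?reduced_act //.
by apply: leq_trans (size_tact _ _) _; rewrite addSn ltnS.
Qed.

Lemma size_act f : exists C, forall x, reduced x.1 ->
  (size (act f x).1 <= C + size x.1)%N.
Proof.
by rewrite [f]normal_form; eexists=> x; apply: size_act_seq_val.
Qed.

Lemma reduced_cat L d r L' : reduced (rcons L (d, r)) -> head_ok d L' ->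
  reduced L' -> reduced (rcons L (d, r) ++ L').
Proof.
move=> + hd hL'; elim: L => [|[d' r'] L IHL] /=.
  by rewrite hd hL' !andbT.
case/and3P=> -> h1 /IHL->; rewrite andbT.
by case: L {IHL} h1.
Qed.

(** The sequence [L] need not be reduced; only the least such [n] matters, and there it is the
    syllable length of a normal form. *)
Definition conj_length (a : hnn) n : Prop :=
  exists y L g, size L = n /\ y * a * y^-1 = seq_val L * base_in g.

(* An element whose syllable length is positive and minimal in its conjugacy
   class is cyclically reduced, so lengths of its powers are additive. *)
Lemma size_act_expg a n :
    (0 < n)%N -> conj_length a n -> (forall m, conj_length a m -> (n <= m)%N) ->
  exists y L g, [/\ size L = n, y * a * y^-1 = seq_val L * base_in g &
    forall k, size (act ((seq_val L * base_in g) ^+ k) origin).1 = (k * n)%N].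
Proof.
move=> n0 [y [L0 [g0 [sL0 e0]]]] nmin.
pose f := y * a * y^-1; pose L := (act f origin).1; pose g := (act f origin).2.
have fE : f = seq_val L * base_in g by apply: normal_form.
(* The normal form is no longer than the given expression, and no shorter by minimality. *)
have sL : size L = n.
  apply/eqP; rewrite eqn_leq nmin ?andbT; last by exists y, L, g.
  by rewrite /L /f e0 -sL0 -[X in (_ <= X)%N]addn0 (@size_act_seq_val L0 g0 origin).
have hL : reduced L by apply: (@reduced_act f origin).
exists y, L, g; split; rewrite -?fE //.
case LE: L sL hL fE => [|[d r] L1]; first by move=> nz; rewrite -nz in n0.
rewrite -LE => sL hL fE.
have [L2 [d2 [r2 LE2]]] : exists L2 d2 r2, L = rcons L2 (d2, r2).
  by case/lastP: (L) LE => // L2 [d2 r2] _; exists L2, d2, r2.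
(* If the last letter of [L] cancelled against the first one across [g], conjugating by the first
   syllable would save two syllables, contradicting minimality. *)
have cyc : head_ok d2 ((d, coset_rep d (g * r)) :: L1).
  apply/negP => /andP[/eqP ed /eqP er].
  have [c hc] := coset_rep_eq1 er.
  case/lastP: L1 LE => [LE|L1 [d3 r3] LE].
    move: LE2; rewrite LE => /(congr1 (last (d, r))); rewrite last_rcons /= => -[h _].
    by move: (revd_neq d2); rewrite -ed h eqxx.
  have [ed3 er3] : d3 = d2 /\ r3 = r2.
    move: LE2; rewrite LE => /(congr1 (last (d, r))).
    by rewrite last_rcons -rcons_cons last_rcons => -[].
  subst d3 r3 d; move: (hc) => hc'; rewrite src_revd in hc'.
  have : conj_length a (size L1).
    pose z := base_in r * stable (revd d2).
    exists (z^-1 * y), L1, (r2 * src (d := d2) c); split=> //.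
    have -> : z^-1 * y * a * (z^-1 * y)^-1 = z^-1 * f * z.
      by rewrite /f; move: (z) => z'; rewrite invgM invgK !mulgA.
    have fz : f = z * (seq_val (rcons L1 (d2, r2)) * base_in g).
      by rewrite fE LE /seq_val big_cons mulgA.
    rewrite fz mulKg /seq_val -cats1 big_cat big_seq1 /= /z !mulgA.
    rewrite -(mulgA _ (base_in g)) -base_inM hc' -(mulgA _ (stable d2)) stable_rel.
    by rewrite stable_revd !mulgA mulgK base_inM !mulgA.
  move/nmin; rewrite -sL LE /= size_rcons.
  by move/(leq_trans (leqnSn _)); rewrite ltnn.
(* The first syllable of [f ^+ k] is carried along, since it decides whether the next factor [f]
   cancels. *)
suff H k : let x := act (f ^+ k) origin in
    size x.1 = (k * n)%N /\ (k = 0%N \/ exists L', x.1 = (d, r) :: L').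
  by move=> k; have [] := H k.
elim: k => [|k /= [IH1 IH2]]; first by rewrite act1 //; split=> //; left.
rewrite expgS actM //; set x := act _ origin in IH1 IH2 *.
have hx : reduced x.1 by apply: reduced_act.
have hgx : reduced (bact g x).1 by apply: reduced_bact.
have hLx : reduced (L ++ (bact g x).1).
  rewrite LE2; apply: reduced_cat; rewrite -?LE2 //.
  case: IH2 => [k0|[L']].
    by move: IH1; rewrite k0 mul0n -(size_bact g x); case: (bact g x).1.
  by move: cyc; case: (x) => xL xg /= cyc ->.
have -> : act f x = (L ++ (bact g x).1, (bact g x).2).
  by rewrite {1}fE actM // act_base // act_seq_val.
rewrite /= size_cat sL size_bact IH1 mulSn; split=> //; right.
by rewrite LE; eexists.
Qed.

Lemma almost_BS_elliptic (a s : hnn) p q :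
    (0 < p)%N -> (p < q)%N -> s * a ^+ p * s^-1 = a ^+ q ->
  exists y b, y * a * y^-1 = base_in b.
Proof.
move=> p0 ltpq rel.
have exn : exists n, `[< conj_length a n >].
  exists (size (act a origin).1); apply/asboolP; exists 1, (act a origin).1, (act a origin).2.
  by split=> //; rewrite mul1g invg1 mulg1 -normal_form.
case: (ex_minnP exn) => n /asboolP an nmin.
have {}nmin m : conj_length a m -> (n <= m)%N by move=> h; apply/nmin/asboolP.
case: (posnP n) => [n0|n0].
  case: an => y [L [g [sL e]]]; exists y, g; rewrite e n0 in sL *.
  by case: L sL {e} => // _; rewrite /seq_val big_nil mul1g.
have [y [L [g [sL fE len]]]] := size_act_expg n0 an nmin.
set f := seq_val L * base_in g in fE len.
pose t := y * s * y^-1.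
have relk k : t * f ^+ (p * k) * t^-1 = f ^+ (q * k).
  rewrite !expgnA conj_expg; congr (_ ^+ _).
  rewrite -fE -!conj_expg -rel /t !invgM invgK !mulgA !mulgVK //.
have bound m x : reduced x.1 -> (size (act (f ^+ m) x).1 <= m * n + size x.1)%N.
  move=> hx; elim: m => [|m IHm]; first by rewrite act1.
  rewrite expgS actM //; apply: leq_trans (size_act_seq_val _ _ _) _.
    exact: reduced_act.
  by rewrite sL mulSn -addnA leq_add2l.
clearbody t f; have [C1 hC1] := size_act t; have [C2 hC2] := size_act t^-1.
(* Conjugation by [t] adds at most [C1 + C2] syllables, while the lengths of [f ^+ (q * k)] and
   [f ^+ (p * k)] differ by at least [k * n], which is larger. *)
pose k := (C1 + C2).+1.
have := len (q * k)%N; rewrite -relk => e.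
have : (q * k * n <= C1 + (p * k * n + C2))%N.
  rewrite -e !actM // ?reduced_act //.
  apply: leq_trans (hC1 _ _) _; rewrite ?reduced_act // leq_add2l.
  apply: leq_trans (bound _ _ _) _; rewrite ?reduced_act // leq_add2l.
  by apply: leq_trans (hC2 _ _) _; rewrite //= addn0.
move=> le; exfalso; move: le; apply/negP; rewrite -ltnNge addnCA.
apply: (@leq_trans (p.+1 * k * n)); last by rewrite !leq_mul2r ltpq !orbT.
by rewrite mulSn mulnDl addnC ltn_add2r; apply: leq_pmulr.
Qed.

Variable (N : B -> rat).
Hypotheses (N_conj : forall g b, N (g * b * g^-1) = N b)
  (N_edge : forall e (c : A e), N (fp e c) = N (fm e c)).

(** If [b' * x = x * b] for a normal form [x], then [b'] travels through [x] unchanged in weight: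
    each syllable conjugates it by a representative and replaces some [src c] by [tgt c]. *)
Lemma weight_bact b b' x : bact b' x = rmul b x -> N b' = N b.
Proof.
have Nst d (c : A d.1) : N (src c) = N (tgt c) by case: d c => e [] c /=; rewrite N_edge.
case: x => L g; elim: L b' => [|[d r] L IHL] b'.
  by rewrite /bact /rmul /= => -[h]; rewrite -(N_conj g b) -h mulgK.
rewrite bact_cons /rmul /= => -[hr h1 h2].
rewrite -(N_conj r^-1) invgK.
have -> : r^-1 * b' * r = src (cofactor d (b' * r)).
  by rewrite -mulgA {1}(coset_repE fp fm d (b' * r)) hr mulKg.
by rewrite Nst; apply: IHL; rewrite [LHS]surjective_pairing h1 h2.
Qed.

(** With [x] the normal form of [s], the relation [s * b = b' * s] becomes the equation of
    [weight_bact]. *)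
Lemma weight_hnn_conj s b b' : s * base_in b * s^-1 = base_in b' -> N b = N b'.
Proof.
move/conjg_mulP/(congr1 (act^~ origin)); rewrite !actM // !act_base ?reduced_act //.
rewrite [bact b _](_ : _ = rmul b origin); last by rewrite /bact /rmul /= mulg1 mul1g.
by rewrite act_rmul // => /esym/weight_bact.
Qed.

Hypotheses (N_X : forall b n, N (b ^+ n) = (N b *+ n)%R)
  (N_pos : forall b, infinite_order b -> (0 < N b)%R).

Lemma hnn_no_almost_BS (a s : hnn) p q :
    (0 < p)%N -> (p < q)%N -> s * a ^+ p * s^-1 = a ^+ q ->
  ~ infinite_order a.
Proof.
move=> p0 ltpq rel ainf; have [y [b yb]] := almost_BS_elliptic p0 ltpq rel.
have XE n : base_in (b ^+ n) = y * a ^+ n * y^-1.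
  by rewrite (morph_mulgX base_inM) -yb conj_expg.
have binf : infinite_order b.
  move=> n n0 bn; apply: (ainf n n0); apply: (mulgI y); apply: (mulIg y^-1).
  by rewrite -XE bn mulg1 mulgV; apply: morph_mulg1 base_inM.
have /weight_hnn_conj : (y * s * y^-1) * base_in (b ^+ p) * (y * s * y^-1)^-1 =
    base_in (b ^+ q).
  by rewrite !XE -rel !invgM invgK !mulgA !mulgVK.
have /lt0r_neq0 Nb := N_pos binf; move/eqP.
by rewrite !N_X eq_sym -subr_eq0 -mulrnBr ?(ltnW ltpq) // mulrn_eq0 (negPf Nb) orbF subn_eq0 leqNgt ltpq.
Qed.

End HNN.

(** * Two-ended groups *)

Section Orders.
Variable G : groupType.
Implicit Types a b g x z : G.

Lemma infinite_orderV g : infinite_order g -> infinite_order g^-1.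
Proof. by move=> h n n0 /eqP; rewrite expVgn invg_eq1 => /eqP; apply: h. Qed.

Lemma infinite_orderX g n : (0 < n)%N -> infinite_order g -> infinite_order (g ^+ n).
Proof. by move=> n0 h m m0; rewrite -expgnA; apply: h; rewrite muln_gt0 n0. Qed.

Lemma expg_inj g : infinite_order g -> injective (fun n => g ^+ n).
Proof.
move=> h; suff H m n : (m < n)%N -> g ^+ m <> g ^+ n.
  by move=> m n e; case: (ltngtP m n) => // l; [case: (H _ _ l)|case: (H _ _ l)].
move=> l e; apply: (h (n - m)%N); first by rewrite subn_gt0.
by rewrite expgnFr ?(ltnW l) // -e mulgV.
Qed.

Lemma orbit_leaves_finite g z (F : set G) : infinite_order g -> finite_set F ->
  exists n0, forall n, (n0 <= n)%N -> ~ F (g ^+ n * z).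
Proof.
move=> ginf /finite_seqP[s ->]; elim: s => [|x s [n0 IHs]]; first by exists 0%N.
case: (pselect (exists m, g ^+ m * z = x)) => [[m em]|no].
  exists (maxn n0 m.+1) => n; rewrite geq_max => /andP[h1 h2] /=.
  rewrite inE => /orP[/eqP|]; last exact: IHs.
  by rewrite -em => /mulIg/(expg_inj ginf) e; rewrite e ltnn in h2.
exists n0 => n h /=; rewrite inE => /orP[/eqP e|]; last exact: IHs.
by apply: no; exists n.
Qed.

Lemma finite_pigeonhole (F : set G) (f : nat -> G) : finite_set F ->
  (forall n, F (f n)) -> exists m n, (m < n)%N /\ f m = f n.
Proof.
case/finite_seqP=> s -> hf.
have : ~~ uniq (map f (iota 0 (size s).+1)).
  apply/negP => u.
  have : (size (map f (iota 0 (size s).+1)) <= size s)%N.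
    by apply: uniq_leq_size u _ => x /mapP[i _ ->]; apply: hf.
  by rewrite size_map size_iota ltnn.
case/(uniqPn 1) => i [j [ij]]; rewrite size_map size_iota => jl.
rewrite !(nth_map 0%N) ?size_iota ?(ltn_trans ij) // !nth_iota ?(ltn_trans ij) //.
by exists i, j.
Qed.

(** The set [F] meets every coset [<g> z]. By pigeonhole two powers of [b] are moved to the same
    point of [F], so their quotient is a power of [g]; it is nontrivial since [b] has infinite
    order. *)
Lemma finite_index_commensurable (F : set G) g b :
    infinite_order b -> finite_set F ->
    (forall z, exists k n, F (g ^+ k * (g ^- n * z))) ->
  exists m n, [/\ (0 < m)%N, (0 < n)%N & b ^+ m = g ^+ n \/ b ^+ m = (g ^+ n)^-1].
Proof.
move=> binf finF cov.
have shift i j l z : g ^+ (i + j) * (g ^+ l * (g ^- i * z)) = g ^+ (l + j) * z.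
  by rewrite !mulgA -expgnDr -addnA addnC (addnC j) expgnDr mulgK.
have /choice[kn hkn] m : exists kn : nat * nat,
    F (g ^+ kn.1 * (g ^- kn.2 * b ^+ m)).
  by have [k [n h]] := cov (b ^+ m); exists (k, n).
have [m [m' [lt_m e]]] := finite_pigeonhole finF hkn.
set I := (kn m).1 + (kn m').2; set J := (kn m').1 + (kn m).2.
(* Both sides of [e] are multiplied by a power of [g] that clears the negative exponents. *)
have key : g ^+ J * b ^+ m' = g ^+ I * b ^+ m.
  by rewrite /I /J -(shift (kn m').2 (kn m).2) -[in RHS](shift (kn m).2) e addnC.
have bm : b ^+ (m' - m) * b ^+ m = b ^+ m' by rewrite -expgnDr subnK ?(ltnW lt_m).
have m0 : (0 < m' - m)%N by rewrite subn_gt0.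
case: (ltngtP I J) key => IJ key.
- exists (m' - m)%N, (J - I)%N; split; rewrite ?subn_gt0 //; right.
  apply: (mulIg (b ^+ m)); rewrite bm; apply: (mulgI (g ^+ J)); rewrite key mulgA.
  by rewrite -expgnFr ?leq_subr // subKn ?(ltnW IJ).
- exists (m' - m)%N, (I - J)%N; split; rewrite ?subn_gt0 //; left.
  apply: (mulIg (b ^+ m)); rewrite bm; apply: (mulgI (g ^+ J)); rewrite key mulgA.
  by rewrite -expgnDr subnKC ?(ltnW IJ).
- move: key; rewrite IJ => /mulgI/(expg_inj binf) e'.
  by rewrite e' ltnn in lt_m.
Qed.

End Orders.

(** * Cutting the Cayley graph of a two-ended group *)

Section Ends.
Variables (G : groupType) (S : seq G).
Hypothesis genS : generates S.
Implicit Types (g x y z : G) (K : seq G) (P Q U V : set G).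

Local Notation adj := (cayley_adj S).

Lemma cayley_adj_sym : symmetric adj.
Proof. by move=> x y; rewrite /cayley_adj orbC. Qed.

Lemma cayley_adj_mull g x y : adj (g * x) (g * y) = adj x y.
Proof. by rewrite /cayley_adj !invgM -!mulgA !mulKg. Qed.

Lemma joined_refl K x : x \notin K -> joined_outside S K x x.
Proof. by move=> h; exists [::]; split=> // z; rewrite inE => /eqP->. Qed.

Lemma joined_step K x y z : x \notin K -> adj x y ->
  joined_outside S K y z -> joined_outside S K x z.
Proof.
move=> hx xy [p [pp lp hp]]; exists (y :: p); split=> //=; first by rewrite xy.
by move=> t; rewrite inE => /orP[/eqP->|/hp].
Qed.

Lemma joined_sym K x y : joined_outside S K x y -> joined_outside S K y x.
Proof.
case=> p [pp lp hp]; exists (rev (belast x p)); split.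
- by rewrite -lp (@eq_path _ _ (fun u v => adj v u)) ?rev_path // => u v;
    apply: cayley_adj_sym.
- by case: p {pp hp} lp => //= u p _; rewrite rev_cons last_rcons.
- move=> z hz; apply: hp; rewrite lastI lp mem_rcons.
  by move: hz; rewrite !inE mem_rev.
Qed.

Lemma joined_notin K x y : joined_outside S K x y -> x \notin K /\ y \notin K.
Proof. by case=> p [_ <- hp]; split; apply: hp; rewrite ?mem_head ?mem_last. Qed.

Definition closed_outside K P : Prop :=
  forall x y, P x -> adj x y -> y \notin K -> P y.

Lemma closed_joined K P x y : closed_outside K P -> P x ->
  joined_outside S K x y -> P y.
Proof.
move=> cl + [p []]; elim: p x => [|z p IHp] x /=; first by move=> Px _ <- _.
move=> Px /andP[xz pp] lp hp; apply: (IHp z) => //; first apply: (cl x) => //.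
  by apply: hp; rewrite !inE eqxx orbT.
by move=> t ht; apply: hp; rewrite inE ht orbT.
Qed.

Lemma joined_rstep K x y z : joined_outside S K x y -> adj y z -> z \notin K ->
  joined_outside S K x z.
Proof.
move=> /joined_sym xy yz hz; apply: joined_sym.
by apply: joined_step xy => //; rewrite cayley_adj_sym.
Qed.

Lemma joined_closed K x : closed_outside K [set y | joined_outside S K x y]%classic.
Proof. by move=> y z; apply: joined_rstep. Qed.

Lemma joined_trans K x y z : joined_outside S K x y ->
  joined_outside S K y z -> joined_outside S K x z.
Proof. by move=> h; apply: (closed_joined (@joined_closed K x) h). Qed.

Lemma cayley_connected x y : joined_outside S [::] x y.
Proof.
pose H := [set g | forall x, joined_outside S [::] x (x * g)]%classic.
have subH : subgroup H.
  split=> [z|g h hg hh z]; first by rewrite mulg1; apply: joined_refl.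
  apply: joined_trans (hg z) _; rewrite mulgA; apply: joined_sym.
  by rewrite -{2}(mulgVK h (z * g)); apply: hh.
have : generated [set` S]%classic (x^-1 * y) by rewrite genS.
have sH : ([set` S] `<=` H)%classic.
  move=> s /= sS z; apply: (@joined_step _ _ (z * s)) => //; last exact: joined_refl.
  by rewrite /cayley_adj mulKg sS.
by move/(smallest_sub subH sH)/(_ x); rewrite mulVKg.
Qed.

Lemma finite_neighbours K : finite_set [set y | exists2 k, k \in K & adj k y]%classic.
Proof.
apply: (@sub_finite_set _ _ [set` [seq k * s | k <- K, s <- S ++ map (fun s => s^-1) S]]).
  move=> y /= [k kK /orP ky]; apply/allpairsP; exists (k, k^-1 * y).
  rewrite mulVKg; split=> //=; rewrite mem_cat; case: ky => [->//|h].
  by apply/orP; right; apply/mapP; exists (y^-1 * k); rewrite // invgM invgK.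
exact: finite_seq.
Qed.

(** A path from a point of [P] to [K] leaves [P] through a neighbour of [K]. There are finitely many
    of these, so [P] is covered by finitely many components and one is infinite. For empty [K] the
    whole graph is the component. *)
Lemma infinite_component K P : infinite_set P -> (forall x, P x -> x \notin K) ->
  closed_outside K P ->
  exists x, P x /\ infinite_set [set y | joined_outside S K x y]%classic.
Proof.
move=> Pinf PK cl; case: K PK cl => [|k K'] PK cl.
  have [x Px] := infinite_setN0 Pinf; exists x; split=> // fin; apply: Pinf.
  by apply: sub_finite_set fin => y _; apply: cayley_connected.
set K := k :: K' in PK cl *; apply: contrapT => no; apply: Pinf.
pose D := ([set y | exists2 k, k \in K & adj k y] `&` P)%classic.
have : finite_set (\bigcup_(y in D) [set z | joined_outside S K y z])%classic.
  apply: bigcup_finite; first exact/finite_setIl/finite_neighbours.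
  by move=> y [_ Py]; apply: contrapT => inf; apply: no; exists y.
apply: sub_finite_set => x Px.
have [p [pp lp _]] := cayley_connected x k.
elim: p x Px pp lp => [|z p IHp] x Px /= pp lp.
  by move: (PK x Px); rewrite lp mem_head.
case/andP: pp => xz pp; case: (boolP (z \in K)) => [zK|zK].
  exists x; last exact/joined_refl/PK.
  by split=> //; exists z; rewrite // cayley_adj_sym.
have [y Dy /= yz] := IHp z (cl x z Px xz zK) pp lp.
by exists y => //=; apply: joined_rstep yz _ (PK x Px); rewrite cayley_adj_sym.
Qed.

(** Pieces need not be connected, only closed outside [K], so ends can be counted without
    identifying components. *)
Lemma ends_of_pieces n K (P : 'I_n -> set G) :
    (forall i, infinite_set (P i)) -> (forall i x, P i x -> x \notin K) ->
    (forall i, closed_outside K (P i)) ->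
    (forall i j x, i != j -> P i x -> ~ P j x) ->
  at_least_ends S n.
Proof.
move=> Pinf PK cl dis.
have /choice[x hx] i := infinite_component (Pinf i) (PK i) (cl i).
exists K, x; split=> [i|i j ij xij]; first by have [] := hx i.
have [Pi _] := hx i; have [Pj _] := hx j.
exact: (dis i j (x j) ij (closed_joined (cl i) Pi xij) Pj).
Qed.

Definition end_piece K P : Prop :=
  [/\ infinite_set P, (forall x, P x -> x \notin K) & closed_outside K P].

Lemma three_ends K P0 P1 P2 : end_piece K P0 -> end_piece K P1 -> end_piece K P2 ->
    (forall x, P0 x -> ~ P1 x) -> (forall x, P0 x -> ~ P2 x) ->
    (forall x, P1 x -> ~ P2 x) ->
  at_least_ends S 3.
Proof.
move=> h0 h1 h2 d01 d02 d12.
have h (i : 'I_3) : end_piece K (nth set0 [:: P0; P1; P2] i) by case: i => -[|[|[|//]]].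
apply: (@ends_of_pieces 3 K (fun i => nth set0 [:: P0; P1; P2] i)).
- by move=> i; have [] := h i.
- by move=> i; have [] := h i.
- by move=> i; have [] := h i.
case=> [[|[|[|//]]] hi] [[|[|[|//]]] hj] x //= _ px qx.
- exact: (d01 x).
- exact: (d02 x).
- exact: (d01 x).
- exact: (d12 x).
- exact: (d02 x).
- exact: (d12 x).
Qed.

Definition end_split U V : Prop :=
  [/\ infinite_set U, infinite_set V, finite_set (~` (U `|` V))%classic,
      (forall x, U x -> ~ V x) & (forall x y, U x -> V y -> ~ adj x y)].

(** Connectedness is stated as an induction principle along edges inside [U], the form in which
    [finite_index_cycle] applies it. *)
Definition adj_connected U : Prop :=
  forall Q, (forall x y, U x -> U y -> adj x y -> Q x -> Q y) ->
  forall x y, U x -> U y -> Q x -> Q y.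

Lemma end_split_sym U V : end_split U V -> end_split V U.
Proof.
case=> iU iV fW d e; split=> //; first by rewrite setUC.
  by move=> x Vx Ux; apply: (d x).
by move=> x y Vx Uy; rewrite cayley_adj_sym; apply: e.
Qed.

Lemma joined_adj_connected K x : adj_connected [set y | joined_outside S K x y]%classic.
Proof.
move=> Q hQ y z /= xy xz Qy; have := joined_trans (joined_sym xy) xz.
case=> p [pp lp hp]; elim: p y xy Qy pp lp hp => [|t p IHp] y xy Qy /=.
  by move=> _ <-.
case/andP=> yt pp lp hp.
have tK : t \notin K by apply: hp; rewrite !inE eqxx orbT.
have xt := joined_rstep xy yt tK.
apply: (IHp t) => //; first exact: (hQ y).
by move=> u hu; apply: hp; rewrite inE hu orbT.
Qed.

Hypotheses (two : at_least_ends S 2) (not_three : ~ at_least_ends S 3).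

(** Take two infinite components outside [K]. What remains outside [K] is closed, so if it were
    infinite it would yield a third end. *)
Lemma end_split_exists : exists U V, [/\ end_split U V, adj_connected U & adj_connected V].
Proof.
case: two => K [x [xinf xdis]].
pose U := [set y | joined_outside S K (x ord0) y]%classic.
pose V := [set y | joined_outside S K (x ord_max) y]%classic.
exists U, V; split; try exact: joined_adj_connected.
have ij : ~ joined_outside S K (x ord0) (x ord_max) by apply: xdis.
have dUV y : U y -> ~ V y by move=> Uy /joined_sym Vy; apply: ij; apply: joined_trans Uy Vy.
split=> //; try exact: xinf.
- apply: contrapT => Winf; apply: not_three.
  pose W := (~` (U `|` V) `\` [set` K])%classic.
  apply: (@three_ends K U V W).
  + by split; [exact: xinf|by move=> y h; have [] := joined_notin h|exact: joined_closed].
  + by split; [exact: xinf|by move=> y h; have [] := joined_notin h|exact: joined_closed].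
  + split; first exact/infinite_setD; first by move=> y [_ /negP].
    move=> y z [nUV yK] yz zK; split; last exact/negP.
    by case=> h; apply: nUV; [left|right]; apply: joined_rstep h _ _;
       rewrite 1?cayley_adj_sym //; apply/negP.
  + exact: dUV.
  + by move=> y Uy [nUV _]; apply: nUV; left.
  + by move=> y Vy [nUV _]; apply: nUV; right.
- move=> y z Uy Vz yz; have [_ zK] := joined_notin Vz.
  exact: (dUV z (joined_rstep Uy yz zK)).
Qed.

(** * The action of the group on its two ends *)

Section Translates.
Variables U V : set G.
Hypothesis UV : end_split U V.

Definition translate g P : set G := [set x | P (g^-1 * x)]%classic.

Lemma finite_translate g P : finite_set P -> finite_set (translate g P).
Proof.
move=> fP; apply: sub_finite_set (finite_image (fun x => g * x) fP).
by move=> x Px; exists (g^-1 * x); rewrite // mulVKg.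
Qed.

Lemma infinite_translate g P : infinite_set P -> infinite_set (translate g P).
Proof.
move=> iP fP; apply: iP; apply: sub_finite_set (finite_translate g^-1 fP).
by move=> x Px; rewrite /translate /= invgK mulKg.
Qed.

Definition preserves_ends g : Prop :=
  finite_set (translate g U `&` V)%classic /\ finite_set (translate g V `&` U)%classic.

Definition swaps_ends g : Prop :=
  finite_set (translate g U `&` U)%classic /\ finite_set (translate g V `&` V)%classic.

(** Outside [K] every vertex lies on a side of both splittings, and no edge joins opposite sides of
    either, so an edge cannot leave the intersection. *)
Lemma translated_piece g K P Q P' Q' :
    (forall x, P x -> ~ Q x) -> (forall x, P' x -> ~ Q' x) ->
    (forall x y, P x -> Q y -> ~ adj x y) -> (forall x y, P' x -> Q' y -> ~ adj x y) ->
    (forall x, x \notin K -> (P x \/ Q x) /\ (translate g P' x \/ translate g Q' x)) ->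
    (forall x, P x -> translate g P' x -> x \notin K) ->
    infinite_set (translate g P' `&` P)%classic ->
  end_piece K (translate g P' `&` P)%classic.
Proof.
move=> dPQ dPQ' ePQ ePQ' cov PK inf; split=> // [x [] *|x y [P'x Px] xy yK]; first exact: PK.
have [[Py|Qy] [P'y|Q'y]] := cov y yK; try by [].
- by case: (ePQ' _ _ P'x Q'y); rewrite cayley_adj_mull.
- by case: (ePQ _ _ Px Qy).
- by case: (ePQ _ _ Px Qy).
Qed.

(** Arrange the four intersections of [U], [V] with their translates in a square. Every row and
    column contains an infinite one, and three infinite ones would give three ends, so exactly a
    diagonal is infinite. *)
Lemma preserves_or_swaps_ends g : preserves_ends g \/ swaps_ends g.
Proof.
have [iU iV fW dUV eUV] := UV.
have [_ _ _ dVU eVU] := end_split_sym UV.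
set W := (~` (U `|` V))%classic in fW.
have /finite_seqP[K KE] : finite_set (W `|` translate g W)%classic.
  by rewrite finite_setU; split=> //; apply: finite_translate.
have notK x : x \notin K -> (U x \/ V x) /\ (translate g U x \/ translate g V x).
  move=> xK; have nW : ~ (W `|` translate g W)%classic x by rewrite KE /=; apply/negP.
  by split; apply: contrapT => h; apply: nW; [left|right].
have UVK x : (U x \/ V x) -> (translate g U x \/ translate g V x) -> x \notin K.
  move=> h h'; apply/negP => xK.
  have : (W `|` translate g W)%classic x by rewrite KE.
  by case.
have pUU := @translated_piece g K U V U V dUV dUV eUV eUV.
have pUV := @translated_piece g K V U U V dVU dUV eVU eUV.
have pVU := @translated_piece g K U V V U dUV dVU eUV eVU.
have pVV := @translated_piece g K V U V U dVU dVU eVU eVU.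
have {}pUU : infinite_set (translate g U `&` U)%classic -> end_piece K (translate g U `&` U)%classic.
  apply: pUU => x; [by move/notK; tauto|by move=> *; apply: UVK; tauto].
have {}pUV : infinite_set (translate g U `&` V)%classic -> end_piece K (translate g U `&` V)%classic.
  apply: pUV => x; [by move/notK; tauto|by move=> *; apply: UVK; tauto].
have {}pVU : infinite_set (translate g V `&` U)%classic -> end_piece K (translate g V `&` U)%classic.
  apply: pVU => x; [by move/notK; tauto|by move=> *; apply: UVK; tauto].
have {}pVV : infinite_set (translate g V `&` V)%classic -> end_piece K (translate g V `&` V)%classic.
  apply: pVV => x; [by move/notK; tauto|by move=> *; apply: UVK; tauto].
have dg x : translate g U x -> ~ translate g V x by apply: dUV.
have split2 P P1 P2 : infinite_set P -> (forall x, P x -> x \notin K -> P1 x \/ P2 x) ->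
    infinite_set P1 \/ infinite_set P2.
  move=> inf h; apply: contrapT => /not_orP[/contrapT f1 /contrapT f2]; apply: inf.
  have : finite_set ([set` K] `|` (P1 `|` P2))%classic.
    by rewrite !finite_setU; do !split=> //; apply: finite_seq.
  apply: sub_finite_set => x Px; case: (boolP (x \in K)) => xK; first by left.
  by right; apply: h.
have sU : infinite_set (translate g U `&` U)%classic \/ infinite_set (translate g V `&` U)%classic.
  by apply: split2 iU _ => x Ux /notK[_ []]; [left|right].
have sV : infinite_set (translate g U `&` V)%classic \/ infinite_set (translate g V `&` V)%classic.
  by apply: split2 iV _ => x Ux /notK[_ []]; [left|right].
have sgU : infinite_set (translate g U `&` U)%classic \/ infinite_set (translate g U `&` V)%classic.
  by apply: split2 (infinite_translate (g := g) iU) _ => x Ux /notK[[]]; [left|right].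
have sgV : infinite_set (translate g V `&` U)%classic \/ infinite_set (translate g V `&` V)%classic.
  by apply: split2 (infinite_translate (g := g) iV) _ => x Ux /notK[[]]; [left|right].
have n1 : infinite_set (translate g U `&` U)%classic -> infinite_set (translate g U `&` V)%classic ->
    infinite_set (translate g V `&` U)%classic -> False.
  move=> /pUU h1 /pUV h2 /pVU h3; apply: not_three.
  by apply: three_ends h1 h2 h3 _ _ _ => x [a b] [c d];
     [exact: (dUV x)|exact: (dg x)|exact: (dg x)].
have n2 : infinite_set (translate g U `&` U)%classic -> infinite_set (translate g U `&` V)%classic ->
    infinite_set (translate g V `&` V)%classic -> False.
  move=> /pUU h1 /pUV h2 /pVV h3; apply: not_three.
  by apply: three_ends h1 h2 h3 _ _ _ => x [a b] [c d];
     [exact: (dUV x)|exact: (dUV x)|exact: (dg x)].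
have n3 : infinite_set (translate g U `&` U)%classic -> infinite_set (translate g V `&` U)%classic ->
    infinite_set (translate g V `&` V)%classic -> False.
  move=> /pUU h1 /pVU h2 /pVV h3; apply: not_three.
  by apply: three_ends h1 h2 h3 _ _ _ => x [a b] [c d];
     [exact: (dg x)|exact: (dUV x)|exact: (dUV x)].
have n4 : infinite_set (translate g U `&` V)%classic -> infinite_set (translate g V `&` U)%classic ->
    infinite_set (translate g V `&` V)%classic -> False.
  move=> /pUV h1 /pVU h2 /pVV h3; apply: not_three.
  by apply: three_ends h1 h2 h3 _ _ _ => x [a b] [c d];
     [exact: (dg x)|exact: (dg x)|exact: (dUV x)].
rewrite /preserves_ends /swaps_ends.
case: (pselect (finite_set (translate g U `&` U)%classic)) => a.
  right; split=> //; apply: contrapT => d.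
  by case: sU => // c; case: sgU => // b; apply: n4.
case: (pselect (finite_set (translate g V `&` V)%classic)) => d.
  by case: sV => // b; case: sgV => // c; case: n1.
by left; split; apply: contrapT => h; [apply: n2|apply: n3].
Qed.

Lemma preserves_endsM g h : preserves_ends g -> preserves_ends h -> preserves_ends (g * h).
Proof.
have [_ _ fW _ _] := UV; case=> g1 g2 [h1 h2]; split.
  apply: (@sub_finite_set _ _ (translate g (translate h U `&` V) `|` (translate g U `&` V)
     `|` translate g (~` (U `|` V)))%classic).
    move=> x [+ Vx]; rewrite /translate /= invgM -mulgA => Ux.
    case: (pselect (U (g^-1 * x))) => h3; first by left; right.
    case: (pselect (V (g^-1 * x))) => h4; first by left; left.
    by right; case.
  by rewrite !finite_setU; do !split=> //; apply: finite_translate.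
apply: (@sub_finite_set _ _ (translate g (translate h V `&` U) `|` (translate g V `&` U)
     `|` translate g (~` (U `|` V)))%classic).
  move=> x [+ Vx]; rewrite /translate /= invgM -mulgA => Ux.
  case: (pselect (V (g^-1 * x))) => h3; first by left; right.
  case: (pselect (U (g^-1 * x))) => h4; first by left; left.
  by right; case.
by rewrite !finite_setU; do !split=> //; apply: finite_translate.
Qed.

Lemma swaps_endsM g h : swaps_ends g -> swaps_ends h -> preserves_ends (g * h).
Proof.
have [_ _ fW _ _] := UV; case=> g1 g2 [h1 h2]; split.
  apply: (@sub_finite_set _ _ (translate g (translate h U `&` U) `|` (translate g V `&` V)
     `|` translate g (~` (U `|` V)))%classic).
    move=> x [+ Vx]; rewrite /translate /= invgM -mulgA => Ux.
    case: (pselect (V (g^-1 * x))) => h3; first by left; right.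
    case: (pselect (U (g^-1 * x))) => h4; first by left; left.
    by right; case.
  by rewrite !finite_setU; do !split=> //; apply: finite_translate.
apply: (@sub_finite_set _ _ (translate g (translate h V `&` V) `|` (translate g U `&` U)
     `|` translate g (~` (U `|` V)))%classic).
  move=> x [+ Vx]; rewrite /translate /= invgM -mulgA => Ux.
  case: (pselect (U (g^-1 * x))) => h3; first by left; right.
  case: (pselect (V (g^-1 * x))) => h4; first by left; left.
  by right; case.
by rewrite !finite_setU; do !split=> //; apply: finite_translate.
Qed.

Lemma preserves_endsV g : preserves_ends g -> preserves_ends g^-1.
Proof.
case=> h1 h2; split.
  apply: sub_finite_set (finite_translate g^-1 h2) => x [a b].
  by rewrite /translate /= invgK mulKg; move: a; rewrite /translate /= invgK.
apply: sub_finite_set (finite_translate g^-1 h1) => x [a b].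
by rewrite /translate /= invgK mulKg; move: a; rewrite /translate /= invgK.
Qed.

Lemma preserves_ends_square g : preserves_ends (g * g).
Proof.
by case: (preserves_or_swaps_ends g) => h; [apply: preserves_endsM|apply: swaps_endsM].
Qed.

Lemma preserves_endsX g n : preserves_ends g -> preserves_ends (g ^+ n).
Proof.
have [_ _ _ dUV _] := UV.
move=> hg; elim: n => [|n IHn]; last by rewrite expgS; apply: preserves_endsM.
rewrite expg0; split; rewrite (_ : (_ `&` _)%classic = set0) ?finite_set0 //;
  apply/seteqP; split=> // x []; rewrite /translate /= invg1 mul1g => h1 h2.
  exact: (dUV x).
exact: (dUV x).
Qed.

Definition eventually g P z : Prop := exists n0, forall n, (n0 <= n)%N -> P (g ^+ n * z).

Lemma eventually_cover g z : infinite_order g -> eventually g (U `|` V)%classic z.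
Proof.
have [_ _ fW _ _] := UV; move=> ginf.
have [n0 h] := orbit_leaves_finite z ginf fW.
by exists n0 => n /h/contrapT.
Qed.

(** An orbit step from [U] to [V] lands in the finite set [translate g U] meet [V], and likewise
    backwards. The orbit leaves these sets for good, so it finally stays on one side. *)
Lemma eventually_side g z : infinite_order g -> preserves_ends g ->
  eventually g U z \/ eventually g V z.
Proof.
move=> ginf [f1 f2].
have [n1 h1] := eventually_cover z ginf.
have [n2 h2] := orbit_leaves_finite z ginf f1.
have [n3 h3] := orbit_leaves_finite z ginf f2.
pose n0 := (n1 + n2 + n3)%N.
have l n : (n0 <= n)%N -> [/\ (n1 <= n)%N, (n2 <= n)%N & (n3 <= n)%N].
  move=> h; split; apply: leq_trans h; rewrite /n0 -?addnA ?leq_addr //.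
    by rewrite addnCA leq_addr.
  by rewrite addnA leq_addl.
have tr P n : translate g P (g ^+ n.+1 * z) <-> P (g ^+ n * z).
  by rewrite /translate /= expgS -mulgA mulKg.
have [l1 _ _] := l n0 (leqnn _).
case: (h1 n0 l1) => h0; [left|right]; exists n0 => n /subnK<-; elim: (n - n0)%N => // m IHm.
  have [a b c] := l (m.+1 + n0)%N (leq_addl _ _).
  case: (h1 _ a) => // Vn; case: (h2 _ b); split=> //; exact/tr.
have [a b c] := l (m.+1 + n0)%N (leq_addl _ _).
case: (h1 _ a) => // Vn; case: (h3 _ c); split=> //; exact/tr.
Qed.

(** Neighbours have neighbouring orbits, and no edge joins [U] to [V]; connectedness spreads the
    side to all vertices. *)
Lemma eventually_all g z z' : infinite_order g -> preserves_ends g ->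
  eventually g V z -> eventually g V z'.
Proof.
have [_ _ _ dUV eUV] := UV.
move=> ginf hg + ; have [p [+ + _]] := cayley_connected z z'.
elim: p z => [|t p IHp] z /=; first by move=> _ ->.
case/andP=> zt pp lp [n1 h1]; apply: IHp pp lp _.
case: (eventually_side t ginf hg) => // -[n2 h2]; exfalso.
have := eUV _ _ (h2 _ (leq_maxr n1 n2)) (h1 _ (leq_maxl n1 n2)).
by rewrite cayley_adj_sym cayley_adj_mull.
Qed.

Hypothesis conU : adj_connected U.

(* If the positive orbits of [g] go to the side [V], the translates of the
   finite set between the sides miss [U], so that [g^-n U] lies in [U]: the
   negative orbits go to [U], and every orbit crosses a fixed finite set. *)
Lemma finite_index_cycle g z0 : infinite_order g -> preserves_ends g ->
    eventually g V z0 ->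
  exists F : set G, finite_set F /\ forall z, exists k n, F (g ^+ k * (g ^- n * z)).
Proof.
have [iU iV fW dUV eUV] := UV.
move=> ginf hg ev0; have ev z : eventually g V z by apply: eventually_all ev0.
set W := (~` (U `|` V))%classic in fW.
(* One [n0] serves all of [W] because [W] is finite. *)
have [n0 hn0] : exists n0, forall n, (n0 <= n)%N -> forall w, W w -> V (g ^+ n * w).
  case/finite_seqP: fW => s ->; elim: s => [|w s [n1 IHs]]; first by exists 0%N.
  have [n2 h2] := ev w; exists (maxn n1 n2) => n; rewrite geq_max => /andP[l1 l2] w' /=.
  by rewrite inE => /orP[/eqP->|]; [apply: h2|apply: IHs].
have [u Uu] := infinite_setN0 iU.
have back n x : (n0 <= n)%N -> U x -> U (g ^- n * x).
  move=> ln; pose Q := [set x | U (g ^- n * x)]%classic.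
  have notW y : U y -> (U `|` V)%classic (g ^- n * y).
    move=> Uy; apply: contrapT => Wy; apply: (dUV _ Uy).
    by rewrite -(mulVKg (g ^+ n) y); apply: hn0 ln _ Wy.
  have hQ y y' : U y -> U y' -> adj y y' -> Q y -> Q y'.
    move=> Uy Uy' yy' Qy; case: (notW _ Uy') => // Vy'.
    by case: (eUV _ _ Qy Vy'); rewrite cayley_adj_mull.
  have [y [Uy Qy]] : exists y, U y /\ Q y.
    apply: contrapT => no; apply: iU; have [_ f2] := preserves_endsX n hg.
    apply: sub_finite_set f2 => y Uy; split=> //.
    by case: (notW _ Uy) => // Uy'; case: no; exists y.
  by move=> Ux; apply: (conU hQ Uy Ux Qy).
(* If some negative orbit ended in [V], so would that of [u], but [back] keeps it in [U]. *)
have evU z : eventually g^-1 U z.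
  have [] := eventually_side z (infinite_orderV ginf) (preserves_endsV hg) => //.
  move=> evz; have [n1 h1] := eventually_all u (infinite_orderV ginf) (preserves_endsV hg) evz.
  have := h1 _ (leq_maxr n0 n1); rewrite expVgn.
  by move/(dUV _ (back _ _ (leq_maxl n0 n1) Uu)).
have [f1 _] := hg.
exists (W `|` (translate g U `&` V))%classic; split; first by rewrite finite_setU.
move=> z; have [n h] := evU z.
have Uy : U (g ^- n * z) by rewrite -expVgn; apply: h.
have exk : exists k, `[< V (g ^+ k * (g ^- n * z)) >].
  by have [k hk] := ev (g ^- n * z); exists k; apply/asboolP/hk.
(* At the first entry into [V], the preceding point is in [U], and then the entry point lies in
   [translate g U] meet [V], or it is in neither side, hence in [W]. *)
case: (ex_minnP exk) => -[|k] /asboolP Vk mink.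
  by case: (dUV _ Uy); rewrite expg0 mul1g in Vk.
have nV : ~ V (g ^+ k * (g ^- n * z)) by move=> /asboolP/mink; rewrite ltnn.
case: (pselect (U (g ^+ k * (g ^- n * z)))) => Uk.
  exists k.+1, n; right; split=> //.
  by rewrite /translate /= expgS -[X in g^-1 * X]mulgA mulKg.
by exists k, n; left=> -[].
Qed.

End Translates.

Lemma ends_commensurable (a b : G) : infinite_order a -> infinite_order b ->
  exists m n, [/\ (0 < m)%N, (0 < n)%N & b ^+ m = a ^+ n \/ b ^+ m = (a ^+ n)^-1].
Proof.
move=> ainf binf.
(* The element [a] may swap the ends; its square preserves them. *)
have ginf : infinite_order (a * a) by apply: (@infinite_orderX _ a 2).
have [U [V [UV cU cV]]] := end_split_exists.
have pr := preserves_ends_square UV a.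
have [F [finF cov]] : exists F : set G, finite_set F /\
    forall z, exists k n, F ((a * a) ^+ k * ((a * a) ^- n * z)).
  case: (eventually_side UV 1 ginf pr) => ev; last first.
    exact: (finite_index_cycle UV cU ginf pr ev).
  have pr' : preserves_ends V U (a * a) by case: pr.
  exact: (finite_index_cycle (end_split_sym UV) cV ginf pr' ev).
have [m [n [m0 n0 e]]] := finite_index_commensurable binf finF cov.
exists m, (2 * n)%N; rewrite muln_gt0 n0; split=> //.
by rewrite expgnA.
Qed.

End Ends.

Lemma two_ended_commensurable (G : groupType) (a b : G) : two_ended G ->
    infinite_order a -> infinite_order b ->
  exists m n, [/\ (0 < m)%N, (0 < n)%N & b ^+ m = a ^+ n \/ b ^+ m = (a ^+ n)^-1].
Proof.
by case=> S genS [two not_three] ainf binf; exact: (ends_commensurable genS two not_three ainf binf).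
Qed.

(** * Distortion and weights *)

Section Distortion.
Variables (G : groupType) (S : seq G).
Implicit Types (a g s x y : G).

Lemma has_wordM x y m n : has_word_of_size S x m -> has_word_of_size S y n ->
  has_word_of_size S (x * y) (m + n).
Proof.
case=> w [hw <- <-] [w' [hw' <- <-]]; exists (w ++ w'); rewrite big_cat size_cat.
by split=> // s; rewrite mem_cat => /orP[/hw|/hw'].
Qed.

Lemma has_wordV x m : has_word_of_size S x m -> has_word_of_size S x^-1 m.
Proof.
case=> w [hw <- <-]; exists (rev (map (fun s => s^-1) w)); split.
- by move=> s; rewrite mem_rev => /mapP[t /hw h ->]; rewrite invgK orbC.
- elim: w {hw} => [|s w IHw]; first by rewrite !big_nil invg1.
  by rewrite /= rev_cons -cats1 big_cat big_seq1 IHw big_cons invgM.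
- by rewrite size_rev size_map.
Qed.

Lemma has_wordX x m n : has_word_of_size S x m -> has_word_of_size S (x ^+ n) (n * m).
Proof.
move=> h; elim: n => [|n IHn]; last by rewrite expgS mulSn; apply: has_wordM.
by exists [::]; rewrite big_nil.
Qed.

Lemma has_word x : generates S -> exists n, has_word_of_size S x n.
Proof.
move=> genS; have : generated [set` S]%classic x by rewrite genS.
apply: (@smallest_sub _ _ _ [set y | exists n, has_word_of_size S y n]%classic).
  split; first by exists 0%N, [::]; rewrite big_nil.
  by move=> y z [m hm] [n hn]; exists (m + n)%N; apply/has_wordM/has_wordV.
move=> s /= sS; exists 1%N, [:: s]; rewrite big_seq1; split=> // t.
by rewrite inE => /eqP->; rewrite sS.
Qed.

Lemma word_norm_le x n : has_word_of_size S x n -> (word_norm S x <= n)%N.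
Proof.
move=> h; have ex : exists m, `[< has_word_of_size S x m >] by exists n; apply/asboolP.
case: (ex_minnP ex) => m /asboolP hm mmin.
pose P := [set n | has_word_of_size S x n /\
                    forall m, has_word_of_size S x m -> (n <= m)%N]%classic.
have : P (xget 0%N P).
  by apply: (@xgetI _ _ _ m); split=> // k hk; apply/mmin/asboolP.
by case=> _; apply.
Qed.

Lemma exponential_beats_linear p M : (0 < p)%N ->
  exists n, (M * n.+1 * p ^ n < p.+1 ^ n)%N.
Proof.
move=> p0.
(* Bernoulli's inequality [(1 + 1/p)^m >= 1 + m/p], cleared of denominators. Squaring it gives the
   quadratic growth needed against a linear factor. *)
have bern m : (p ^ m * (p + m) <= p * p.+1 ^ m)%N.
  elim: m => [|m IHm]; first by rewrite !expn0 mul1n muln1 addn0.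
  have -> : (p * p.+1 ^ m.+1 = p * p.+1 ^ m * p.+1)%N by rewrite expnSr mulnA.
  apply: leq_trans (leq_mul IHm (leqnn p.+1)).
  rewrite expnSr -!mulnA leq_mul2l; apply/orP; right.
  by nia.
case: (posnP M) => [->|M0]; first by exists 0%N; rewrite !mul0n expn_gt0.
(* Since [2 * m + 1 <= 3 * m], this choice gives [M * (2 * m + 1) * p^2 <= m^2 < (p + m)^2]. *)
pose m := (3 * M * p ^ 2)%N; exists (m * 2)%N.
have m0 : (0 < m)%N by rewrite !muln_gt0 M0 ?expn_gt0 p0.
have p2 : (0 < p ^ 2)%N by rewrite expn_gt0 p0.
rewrite -(ltn_pmul2l p2) [in ltnRHS]expnM -expnMn.
apply: (@leq_trans ((p ^ m * (p + m)) ^ 2)); last by rewrite leq_exp2r.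
rewrite expnMn -expnM mulnA [ltnRHS]mulnC ltn_pmul2r ?expn_gt0 ?p0 //.
apply: (@leq_ltn_trans (m ^ 2)); last by rewrite ltn_exp2r // -[X in (X < _)%N]add0n ltn_add2r.
rewrite {2}/expn /= {2}/m; nia.
Qed.

Lemma conj_expg_iter a s p q n : s * a ^+ p * s^-1 = a ^+ q ->
  s ^+ n * a ^+ (p ^ n) * s ^- n = a ^+ (q ^ n).
Proof.
move=> rel; elim: n => [|n IHn]; first by rewrite !expn0 !expg0 invg1 mulg1 mul1g.
rewrite expgS invgM -!mulgA [s ^+ n * _]mulgA [_ * (s ^- n * _)]mulgA.
rewrite expnSr expgnA conj_expg IHn -expgnA mulnC expgnA mulgA conj_expg rel.
by rewrite -expgnA expnS.
Qed.

(** The power [a ^+ (q ^ n)] equals [s ^+ n * a ^+ (p ^ n) * s ^- n], of word length at most linear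
    in [n] plus a multiple of [p ^ n]; a quasi-isometric embedding needs length of order [q ^ n]. *)
Lemma quasi_isometric_no_BS a s p q : generates S ->
    quasi_isometric_embedding (fun m n : int => absz (m - n)%R) (word_metric S) (expgz a) ->
    (0 < p)%N -> (p < q)%N -> s * a ^+ p * s^-1 = a ^+ q -> False.
Proof.
move=> genS [L [C [L0 qi]]] p0 lt_pq rel.
have [A hA] := has_word s genS; have [B hB] := has_word a genS.
(* The factor comes from [L * (2 * n * A + p ^ n * B + C) <= L * (2 * A + B + C) * n.+1 * p ^ n]. *)
have [n] := exponential_beats_linear (L * (2 * A + B + C)) p0; apply/negP; rewrite -leqNgt.
have [_ low] := qi 0%R (Posz (q ^ n)).
apply: (@leq_trans (q ^ n)); first by case: n {low} => // n; rewrite leq_exp2r.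
move: low; rewrite sub0r abszN /= => low; apply: leq_trans low _.
rewrite -!mulnA leq_mul2l; apply/orP; right.
have : (word_norm S (1^-1 * a ^+ (q ^ n)) <= n * A + p ^ n * B + n * A)%N.
  apply: word_norm_le; rewrite invg1 mul1g -(conj_expg_iter n rel).
  by apply: has_wordM; [apply: has_wordM|]; rewrite -?expVgn; apply: has_wordX => //;
     apply: has_wordV.
rewrite /word_metric => le; apply: leq_trans (leq_add le (leqnn C)) _.
have : (0 < p ^ n)%N by rewrite expn_gt0 p0.
by move: (p ^ n)%N => P; nia.
Qed.

End Distortion.

(** Conjugacy up to inversion matches the absolute values in [balanced] and keeps all exponents
    natural. *)
Definition conj_pm (G : groupType) (x y : G) : Prop :=
  exists g, g * x * g^-1 = y \/ g * x * g^-1 = y^-1.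

Lemma undistorted_conj_pm (G : groupType) (a : G) p q : finitely_generated G ->
  ~ distorted a -> infinite_order a -> conj_pm (a ^+ p) (a ^+ q) -> p = q.
Proof.
move=> [S genS] und ainf [g rel]; apply: contrapT => npq.
have qi : quasi_isometric_embedding (fun m n : int => absz (m - n)%R)
    (word_metric S) (expgz a).
  by apply: contrapT => nqi; apply: und; split=> //; exists S.
have g1 n : g * a ^+ n * g^-1 = 1 -> n = 0%N.
  move/conjg_mulP; rewrite mul1g -{2}[g]mulg1 => /mulgI e.
  by case: n e => // n /(ainf n.+1 isT).
case: (posnP p) => p0.
  rewrite p0 expg0 mulg1 mulgV in rel; apply: npq; rewrite p0.
  by case: q {p0} rel => // q [] /esym; [|move/eqP; rewrite invg_eq1 => /eqP];
     move/(ainf q.+1 isT).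
case: (posnP q) => q0.
  by apply: npq; rewrite q0; apply: g1; case: rel => ->; rewrite q0 ?invg1.
have [j [j0 jq rel']] : exists j : int, [/\ j <> 0%R, absz j = q &
    g * expgz a (Posz p) * g^-1 = expgz a j].
  case: rel => rel; first by exists (Posz q); split=> // -[q0']; rewrite q0' in q0.
  by case: q q0 rel {npq} => // q _ rel; exists (Negz q).
have i0 : Posz p <> 0%R by case=> p0'; rewrite p0' in p0.
have ij : absz (Posz p) <> absz j by rewrite jq.
have [s' [p' [q' [p'0 lt rel'' _]]]] := almost_BS_nat ainf i0 j0 ij rel'.
exact: (quasi_isometric_no_BS genS qi p'0 lt rel'').
Qed.

(** * Weights on a single group *)

Section Weights.
Local Open Scope ring_scope.
Variable V : groupType.
Implicit Types (a b c g x y : V).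

Lemma conj_pm_refl x : conj_pm x x.
Proof. by exists 1%g; left; rewrite mul1g invg1 mulg1. Qed.

Lemma conj_pm_sym x y : conj_pm x y -> conj_pm y x.
Proof.
case=> g h; exists g^-1%g; rewrite invgK.
have h2 : (g^-1 * (g * x * g^-1) * g)%g = x by rewrite !mulgA mulVg mul1g mulgVK.
case: h => e; rewrite e in h2; first by left.
by right; rewrite -h2 -{4}[g]invgK -conj_invg !invgK.
Qed.

Lemma conj_pm_trans x y z : conj_pm x y -> conj_pm y z -> conj_pm x z.
Proof.
move=> [g hg] [h hh]; exists (h * g)%g.
have -> : (h * g * x * (h * g)^-1 = h * (g * x * g^-1) * h^-1)%g by rewrite invgM !mulgA.
case: hg => ->; case: hh => e; rewrite ?conj_invg e ?invgK; by [left|right].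
Qed.

Lemma conj_pmX x y n : conj_pm x y -> conj_pm (x ^+ n)%g (y ^+ n)%g.
Proof.
by case=> g h; exists g; rewrite conj_expg; case: h => ->; [left|right; rewrite expVgn].
Qed.

Lemma conj_pmV x : conj_pm x^-1%g x.
Proof. by exists 1%g; right; rewrite mul1g invg1 mulg1. Qed.

Lemma conj_pm_conj g x : conj_pm (g * x * g^-1)%g x.
Proof. by apply: conj_pm_sym; exists g; left. Qed.

Definition is_weight (N : V -> rat) : Prop :=
  [/\ forall a, infinite_order a -> 0 < N a, forall a n, N (a ^+ n)%g = N a *+ n,
      forall a, N a^-1%g = N a & forall g a, N (g * a * g^-1)%g = N a].

Hypothesis bal : forall a p q, infinite_order a -> conj_pm (a ^+ p)%g (a ^+ q)%g -> p = q.

Definition commens a b (i j : nat) : Prop :=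
  [/\ (0 < i)%N, (0 < j)%N & conj_pm (a ^+ i)%g (b ^+ j)%g].

Lemma commens_sym a b i j : commens a b i j -> commens b a j i.
Proof. by case=> *; split=> //; apply: conj_pm_sym. Qed.

Lemma commens_trans a b c i j k l : commens a b i j -> commens b c k l ->
  commens a c (i * k) (l * j).
Proof.
case=> i0 j0 ab [k0 l0 bc]; split; rewrite ?muln_gt0 ?i0 ?k0 ?l0 //.
apply: (@conj_pm_trans _ (b ^+ (j * k))%g); first by rewrite !expgnA; apply: conj_pmX.
by rewrite mulnC !expgnA; apply: conj_pmX.
Qed.

Lemma conj_pm_infinite x y : conj_pm x y -> infinite_order x -> infinite_order y.
Proof.
move=> /(conj_pm_sym) xy xinf n n0 yn; apply: (xinf n n0).
have [g] := conj_pmX n xy; rewrite yn mulg1 mulgV.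
by case=> [//|/esym/eqP]; rewrite invg_eq1 => /eqP.
Qed.

Lemma commens_infinite a b i j : commens a b i j -> infinite_order a -> infinite_order b.
Proof.
case=> i0 j0 /conj_pm_infinite h /(infinite_orderX i0)/h binf n n0 bn.
by apply: (binf n n0); rewrite expgnAC bn expg1n.
Qed.

(** Going from [b] to [a] by one relation and back by the other relates two powers of [b], whose
    exponents agree by [bal]. *)
Lemma commens_ratio a b i j i' j' : infinite_order a ->
  commens a b i j -> commens a b i' j' -> (j%:R / i%:R : rat) = j'%:R / i'%:R.
Proof.
move=> ainf ab ab'; have [_ _] := commens_trans (commens_sym ab) ab'.
move/(bal (commens_infinite ab ainf)) => e.
case: ab ab' => [i0 _ _] [i0' _ _].
by apply/eqP; rewrite eqr_div ?pnatr_eq0 -?lt0n // -!natrM e.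
Qed.

(** The choice depends only on the set of elements commensurable to [a], so it is shared by the
    whole class. *)
Definition class_rep a : V := xget 1%g [set b | exists i j, commens a b i j]%classic.

Lemma class_repP a : exists i j, commens a (class_rep a) i j.
Proof.
apply: (@xgetPex _ _ [set b | exists i j, commens a b i j]%classic).
by exists a, 1%N, 1%N; split=> //; apply: conj_pm_refl.
Qed.

Lemma class_rep_eq a b i j : commens a b i j -> class_rep a = class_rep b.
Proof.
move=> ab; congr (xget _ _); apply/seteqP; split=> c [k [l h]].
  by exists (j * k)%N, (l * i)%N; apply: commens_trans (commens_sym ab) h.
by exists (i * k)%N, (l * j)%N; apply: commens_trans ab h.
Qed.

(** The representative gets weight 1; then [a^i] conjugate to its [j]-th power forces [j / i].
    Finite order forces weight 0. *)
Definition class_weight a : rat :=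
  if `[< infinite_order a >] then
    xget 0 [set r | exists i j, commens a (class_rep a) i j /\ r = j%:R / i%:R]%classic
  else 0.

Lemma class_weightE a i j : infinite_order a -> commens a (class_rep a) i j ->
  class_weight a = j%:R / i%:R.
Proof.
move=> ainf h; rewrite /class_weight asboolT //; apply: xget_unique.
  by exists i, j.
by move=> _ [i' [j' [h' ->]]]; apply: commens_ratio ainf h' h.
Qed.

Lemma class_weight_commens a b i j : commens a b i j ->
  class_weight a = j%:R / i%:R * class_weight b.
Proof.
move=> ab; case: (pselect (infinite_order a)) => ainf; last first.
  rewrite /class_weight !asboolF ?mulr0 // => binf; apply: ainf.
  exact: commens_infinite (commens_sym ab) binf.
have [k [l bc]] := class_repP b.
rewrite (class_weightE (commens_infinite ab ainf) bc).
rewrite (@class_weightE a (i * k) (l * j)) //.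
  by rewrite !natrM mulrC invfM mulrACA [k%:R^-1 * _]mulrC mulrACA (mulrC _ j%:R) mulrACA.
by rewrite (class_rep_eq ab); apply: commens_trans ab bc.
Qed.

Lemma weight_exists : exists N, is_weight N.
Proof.
exists class_weight; split=> [a ainf|a n|a|g a].
- have [i [j h]] := class_repP a; rewrite (class_weightE ainf h).
  by case: h => i0 j0 _; rewrite divr_gt0 ?ltr0n.
- case: n => [|n].
    rewrite expg0 /class_weight asboolF // => /(_ 1%N isT); apply.
    exact: expg1n.
  rewrite (@class_weight_commens _ a 1 n.+1) ?divr1 ?mulr_natl //.
  by split=> //; apply: conj_pm_refl.
- rewrite (@class_weight_commens _ a 1 1) ?divr1 ?mul1r //.
  by split=> //; apply: conj_pmV.
- rewrite (@class_weight_commens _ a 1 1) ?divr1 ?mul1r //.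
  by split=> //; apply: conj_pm_conj.
Qed.

Lemma weight_finite_order N a : is_weight N -> ~ infinite_order a -> N a = 0.
Proof.
case=> _ NX _ _ /existsNP[n /not_implyP[n0 /contrapT e]].
have := NX a n; rewrite e -(expg0 a) NX mulr0n => /esym/eqP.
by rewrite mulrn_eq0 eqn0Ngt n0 => /eqP.
Qed.

End Weights.

(** * Extending weights over the edges *)

Section VertexConjugacy.
Variable GG : graph_of_groups.
Implicit Types (A : {set edge GG}) (u v w : vertex GG).

Lemma edge_mapM (G H : groupType) (f : {multiplicative G -> H}) : {morph f : x y / x * y}.
Proof. exact: gmulfM. Qed.

Lemma phipX (e : edge GG) (c : egroup e) n : phip e (c ^+ n) = phip e c ^+ n.
Proof. exact: (morph_mulgX (edge_mapM (phip e))). Qed.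

Lemma phimX (e : edge GG) (c : egroup e) n : phim e (c ^+ n) = phim e c ^+ n.
Proof. exact: (morph_mulgX (edge_mapM (phim e))). Qed.

Lemma infinite_order_inj (G H : groupType) (f : {multiplicative G -> H}) c :
  injective f -> infinite_order (f c) <-> infinite_order c.
Proof.
move=> inj; have fX := morph_mulgX (edge_mapM f); have f1 := morph_mulg1 (edge_mapM f).
split=> h n n0 e; apply: (h n n0); first by rewrite -fX e.
by apply: inj; rewrite fX e.
Qed.

(* [vconj A a b] holds when some path running along edges of [A] conjugates [a]
   to [b] or to the inverse of [b]. *)
Inductive vconj A : forall v, vgroup v -> forall w, vgroup w -> Prop :=
| vconj_conj v (g a : vgroup v) : vconj A a (g * a * g^-1)
| vconj_inv v (a : vgroup v) : vconj A a a^-1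
| vconj_edge e (c : egroup e) : e \in A -> vconj A (phip e c) (phim e c)
| vconj_sym v (a : vgroup v) w (b : vgroup w) : vconj A a b -> vconj A b a
| vconj_trans u (a : vgroup u) v (b : vgroup v) w (c : vgroup w) :
    vconj A a b -> vconj A b c -> vconj A a c.

Lemma vconj_refl A v (a : vgroup v) : vconj A a a.
Proof. by have := vconj_conj A 1 a; rewrite mul1g invg1 mulg1. Qed.

Lemma vconjX A v (a : vgroup v) w (b : vgroup w) n :
  vconj A a b -> vconj A (a ^+ n) (b ^+ n).
Proof.
elim=> {v w a b} [v g a|v a|e c eA|v a w b _ IH|u a v b w c _ IH1 _ IH2].
- by rewrite -conj_expg; apply: vconj_conj.
- by rewrite expVgn; apply: vconj_inv.
- by rewrite -phipX -phimX; apply: vconj_edge.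
- exact: vconj_sym.
- exact: vconj_trans IH1 IH2.
Qed.

Definition graph_weight A (N : forall v, vgroup v -> rat) : Prop :=
  (forall v, is_weight (N v)) /\
  (forall e, e \in A -> forall c : egroup e, N _ (phip e c) = N _ (phim e c)).

Lemma graph_weight_vconj A N v (a : vgroup v) w (b : vgroup w) :
  graph_weight A N -> vconj A a b -> N _ a = N _ b.
Proof.
case=> wN eN.
elim=> {v w a b} [v g a|v a|e c eA|v a w b _ IH|u a v b w c _ IH1 _ IH2].
- by have [_ _ _ ->] := wN v.
- by have [_ _ -> _] := wN v.
- exact: eN.
- by [].
- by rewrite IH1.
Qed.

Lemma connect_remove_edge e u v :
  connect (adj [set~ e]%SET) u v ->
  connect (@adj (remove_edge e) [set: edge (remove_edge e)]%SET) u v.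
Proof.
apply: connect_sub => {u v} u v /adjP[f]; rewrite !inE => fe h.
apply/connect1; apply/adjP.
by exists (exist (fun f => f != e) f fe : edge (remove_edge e)).
Qed.

Lemma vconj_connect A v (a : vgroup v) w (b : vgroup w) :
  vconj A a b -> connect (adj A) v w.
Proof.
elim=> {v w a b} [v g a|v a|e c eA|v a w b _ IH|u a v b w c _ IH1 _ IH2].
- exact: connect0.
- exact: connect0.
- exact: connect_edge.
- by rewrite connect_adj_sym.
- exact: connect_trans IH1 IH2.
Qed.

Lemma vconj_pi1 A e (T : {set edge (remove_edge e)}) v (a : vgroup v) w (b : vgroup w) :
    e \notin A -> vconj A a b ->
  conj_pm (@vertex_in (remove_edge e) T v a) (@vertex_in (remove_edge e) T w b).
Proof.
move=> eA.
elim=> {v w a b} [v g a|v a|f c fA|v a w b _ IH|u a v b w c _ IH1 _ IH2].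
- exists (@vertex_in (remove_edge e) T v g); left.
  by rewrite !(@vertex_inM (remove_edge e)) (morph_mulgV (@vertex_inM (remove_edge e) T v)).
- apply/conj_pm_sym; rewrite (morph_mulgV (@vertex_inM (remove_edge e) T v)).
  exact: conj_pmV.
- have fe : f != e by apply: contraNneq eA => <-.
  pose f' : edge (remove_edge e) := exist (fun f => f != e) f fe.
  exists (@stable_letter (remove_edge e) T f'); left; apply/conjg_mulP.
  exact: (@stable_letter_rel (remove_edge e) T f').
- exact: conj_pm_sym.
- exact: conj_pm_trans IH1 IH2.
Qed.

(** The conjugating path itself joins the ends of [e] without using [e], so the complement is
    connected and balancedness is not vacuous. Positivity of [j] allows writing the inverse power
    with a [Negz] exponent. *)
Lemma balanced_vconj A e (c : egroup e) i j : connected_graph GG -> balanced e ->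
    e \notin A -> infinite_order c -> (0 < j)%N ->
  vconj A (phip e c ^+ i) (phim e c ^+ j) -> i = j.
Proof.
move=> conn bal eA cinf j0 cij.
have conn' : connected_graph (remove_edge e).
  case: conn => n0 conn; split=> // u v; apply: connect_remove_edge.
  have := @connect_adjD1 GG [set: edge GG]%SET e u v; rewrite finset.setTD; apply=> //.
  apply: connect_adjS (vconj_connect cij).
  by apply/fintype.subsetP => f fA; rewrite !inE; apply: contraNneq eA => <-.
have [T Tspan] := spanning_tree_exists conn'.
have [h hh] := vconj_pi1 T eA cij.
have b := bal conn' T Tspan c cinf h (Posz i).
rewrite !(morph_mulgX (@vertex_inM (remove_edge e) T _)) in hh.
case: hh => e1; first exact: (b (Posz j)).
by case: j j0 e1 {cij} => // j _ e1; apply: (b (Negz j)).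
Qed.

Local Open Scope ring_scope.

Lemma edge_weight_finite (G H : groupType) (N : H -> rat) (f : {multiplicative G -> H}) c :
  is_weight N -> injective f -> ~ infinite_order c -> N (f c) = 0.
Proof.
by move=> wN inj cfin; apply: weight_finite_order wN _ => /(infinite_order_inj _ inj).
Qed.

Lemma graph_weightS A e N :
    connected_graph GG -> balanced e -> two_ended (egroup e) -> e \notin A ->
    graph_weight A N ->
  exists N', graph_weight (e |: A)%SET N'.
Proof.
move=> conn bal te eA gw; have [wN eN] := gw.
case: (pselect (exists c : egroup e, infinite_order c)) => [[c cinf]|no]; last first.
  exists N; split=> // f; rewrite !inE => /orP[/eqP->|]; last exact: eN.
  move=> c; have cfin : ~ infinite_order c by move=> cinf; apply: no; exists c.
  by rewrite (edge_weight_finite (wN _) (@phip_inj GG e) cfin)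
             (edge_weight_finite (wN _) (@phim_inj GG e) cfin).
have infp : infinite_order (phip e c) by apply/(infinite_order_inj _ (@phip_inj GG e)).
have infm : infinite_order (phim e c) by apply/(infinite_order_inj _ (@phim_inj GG e)).
(* The class to be rescaled: elements with a power that edges of [A] carry to a power of [phim e c].
   It is invariant under [vconj A], so rescaling keeps the edges of [A]. *)
pose cls v (a : vgroup v) : Prop := exists i j,
  [/\ (0 < i)%N, (0 < j)%N & vconj A (a ^+ i)%g (phim e c ^+ j)%g].
have cls_vconj v (a : vgroup v) w (b : vgroup w) : vconj A a b -> cls _ a = cls _ b.
  move=> ab; apply/propext; split=> -[i [j [i0 j0 h]]]; exists i, j; split=> //.
    exact: vconj_trans (vconj_sym (vconjX i ab)) h.
  exact: vconj_trans (vconjX i ab) h.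
have cls_X v (a : vgroup v) n : cls _ (a ^+ n.+1)%g = cls _ a.
  apply/propext; split=> -[i [j [i0 j0 h]]].
    by exists (n.+1 * i)%N, j; split; rewrite ?muln_gt0 ?i0 ?expgnA.
  exists i, (j * n.+1)%N; split; rewrite ?muln_gt0 ?j0 //.
  by rewrite expgnAC (expgnA (phim e c)); apply: vconjX.
pose lam := N _ (phip e c) / N _ (phim e c).
have Np0 : 0 < N _ (phip e c) by case: (wN (endp e)) => + _ _ _; apply.
have Nm0 : 0 < N _ (phim e c) by case: (wN (endm e)) => + _ _ _; apply.
have lam0 : 0 < lam by rewrite divr_gt0.
pose N' v (a : vgroup v) : rat := if `[< cls v a >] then lam * N v a else N v a.
have NX v (a : vgroup v) n : N v (a ^+ n)%g = N v a *+ n by case: (wN v).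
have N'X v (a : vgroup v) n : N' v (a ^+ n)%g = N' v a *+ n.
  rewrite /N'; case: n => [|n]; first by rewrite NX !mulr0n mulr0 if_same.
  by rewrite cls_X NX; case: asboolP => // _; rewrite mulrnAr.
have N'V v (a : vgroup v) : N' v a^-1%g = N' v a.
  by rewrite /N' -(cls_vconj _ _ _ _ (vconj_inv A a)); case: (wN v) => _ _ -> _.
have N'w v : is_weight (N' v).
  split=> // [a ainf|g a].
    by rewrite /N'; case: (wN v) => /(_ a ainf) Na _ _ _; case: ifP => // _; rewrite mulr_gt0.
  by rewrite /N' -(cls_vconj _ _ _ _ (vconj_conj A g a)); case: (wN v) => _ _ _ ->.
exists N'; split=> // f; rewrite !inE => /orP[/eqP->|fA] c'; last first.
  by rewrite /N' (cls_vconj _ _ _ _ (vconj_edge c' fA)) eN.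
(* The factor [lam] gives [phim e c] the weight of [phip e c]. If [phip e c] lies in the same class
   it is rescaled too, but then balancedness forces equal exponents and [lam = 1]. *)
have N'c : N' _ (phip e c) = N' _ (phim e c).
  rewrite {2}/N' asboolT; last by exists 1%N, 1%N; split=> //; apply: vconj_refl.
  rewrite /lam divfK ?gt_eqF // /N'; case: asboolP => // -[i [j [i0 j0 h]]].
  have ij := balanced_vconj conn bal eA cinf j0 h; subst j.
  have := graph_weight_vconj gw h; rewrite !NX => /eqP.
  rewrite eqr_pMn2r // => /eqP Npm.
  by rewrite /lam -Npm divff ?gt_eqF // mul1r.
case: (pselect (infinite_order c')) => c'inf; last first.
  by rewrite (edge_weight_finite (N'w _) (@phip_inj GG e) c'inf)
             (edge_weight_finite (N'w _) (@phim_inj GG e) c'inf).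
(* Two-endedness passes the equality from [c] to every [c'] of infinite order. *)
have [m [n [m0 n0 rel]]] := two_ended_commensurable te cinf c'inf.
have [r1 r2] : N' _ (phip e c') *+ m = N' _ (phip e c) *+ n /\
               N' _ (phim e c') *+ m = N' _ (phim e c) *+ n.
  by case: rel => rel; rewrite -!N'X -!phipX -!phimX rel
    ?(morph_mulgV (edge_mapM (phip e))) ?(morph_mulgV (edge_mapM (phim e))) ?N'V.
by apply/eqP; rewrite -(eqr_pMn2r m0) r1 r2 N'c.
Qed.

Lemma graph_weight_exists :
    connected_graph GG -> (forall e : edge GG, balanced e) ->
    (forall e : edge GG, two_ended (egroup e)) ->
    (forall v : vertex GG, exists N : vgroup v -> rat, is_weight N) ->
  exists N, graph_weight [set: edge GG]%SET N.
Proof.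
move=> conn bal te wex.
suff H n A : (#|A| <= n)%N -> exists N, graph_weight A N by apply: (H _ _ (leqnn _)).
elim: n A => [|n IHn] A.
  rewrite leqn0 cards_eq0 => /eqP->.
  exists (fun v => sval (cid (wex v))); split=> [v|e]; last by rewrite inE.
  by case: (cid (wex v)).
move=> leA; have [->|[e eA]] := set_0Vmem A.
  by apply: IHn; rewrite cards0.
have [|N gw] := IHn (A :\ e)%SET.
  by move: leA; rewrite (cardsD1 e) eA.
have eA' : e \notin (A :\ e)%SET by rewrite !inE eqxx.
by rewrite -(finset.setD1K eA); apply: graph_weightS gw.
Qed.

End VertexConjugacy.

(** * Embedding into an HNN extension *)

Section VertexProduct.
Variable GG : graph_of_groups.

Definition vprod : Type := forall v : vertex GG, vgroup v.
HB.instance Definition _ := gen_eqMixin vprod.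
HB.instance Definition _ := gen_choiceMixin vprod.

Implicit Types b : vprod.

Definition vprod_mul b b' : vprod := fun v => b v * b' v.
Definition vprod_one : vprod := fun v => 1.
Definition vprod_inv b : vprod := fun v => (b v)^-1.

Lemma vprod_mulA : associative vprod_mul.
Proof. by move=> *; apply: functional_extensionality_dep => v; apply: mulgA. Qed.
Lemma vprod_mul1 : left_id vprod_one vprod_mul.
Proof. by move=> *; apply: functional_extensionality_dep => v; apply: mul1g. Qed.
Lemma vprod_mulr1 : right_id vprod_one vprod_mul.
Proof. by move=> *; apply: functional_extensionality_dep => v; apply: mulg1. Qed.
Lemma vprod_mulV : left_inverse vprod_one vprod_inv vprod_mul.
Proof. by move=> *; apply: functional_extensionality_dep => v; apply: mulVg. Qed.
Lemma vprod_mulrV : right_inverse vprod_one vprod_inv vprod_mul.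
Proof. by move=> *; apply: functional_extensionality_dep => v; apply: mulgV. Qed.

HB.instance Definition _ := isGroup.Build vprod
  vprod_mulA vprod_mul1 vprod_mulr1 vprod_mulV vprod_mulrV.

Lemma vprodX b n v : (b ^+ n) v = b v ^+ n.
Proof. by elim: n => // n IHn; rewrite !expgS -IHn. Qed.

Definition single v (g : vgroup v) : vprod := dfwith (fun w => 1 : vgroup w) g.
Arguments single : clear implicits.

Lemma single_in v g : single v g v = g.
Proof. exact: dfwith_in. Qed.

Lemma single_out v g w : v != w -> single v g w = 1.
Proof. exact: dfwith_out. Qed.

Lemma singleM v : {morph single v : g h / g * h}.
Proof.
move=> g h; apply: functional_extensionality_dep => w.
rewrite -[RHS]/(single v g w * single v h w).
have [<-|vw] := eqVneq v w; first by rewrite !single_in.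
by rewrite !single_out ?mulg1.
Qed.

Lemma single_inj v : injective (single v).
Proof. by move=> g h /(congr1 (fun b : vprod => b v)); rewrite !single_in. Qed.

Definition vphip (e : edge GG) (c : egroup e) : vprod := single _ (phip e c).
Definition vphim (e : edge GG) (c : egroup e) : vprod := single _ (phim e c).

Lemma vphipM e : {morph @vphip e : c c' / c * c'}.
Proof. by move=> c c'; rewrite /vphip gmulfM singleM. Qed.
Lemma vphimM e : {morph @vphim e : c c' / c * c'}.
Proof. by move=> c c'; rewrite /vphim gmulfM singleM. Qed.

HB.instance Definition _ e :=
  isMultiplicative.Build (egroup e) vprod (@vphip e) (@vphipM e).
HB.instance Definition _ e :=
  isMultiplicative.Build (egroup e) vprod (@vphim e) (@vphimM e).

Lemma vphip_inj e : injective (@vphip e).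
Proof. by move=> c c' /single_inj/phip_inj. Qed.
Lemma vphim_inj e : injective (@vphim e).
Proof. by move=> c c' /single_inj/phim_inj. Qed.

Definition vphipm (e : edge GG) : {multiplicative egroup e -> vprod} := @vphip e.
Definition vphimm (e : edge GG) : {multiplicative egroup e -> vprod} := @vphim e.

Definition vhnn : groupType := @hnn vprod (edge GG) (@egroup GG) vphipm vphimm vphip_inj vphim_inj.

(** The graph is finite, so if all coordinates had finite order, the product of exponents killing
    them would kill [b]. *)
Lemma infinite_order_coord b : infinite_order b -> exists v, infinite_order (b v).
Proof.
move=> binf; apply: contrapT => no.
have /choice[n hn] (v : vertex GG) : exists n, (0 < n)%N /\ b v ^+ n = 1.
  apply: contrapT => h; apply: no; exists v => n n0 e; apply: h; by exists n.
apply: (binf (\prod_v n v)%N); first by apply: prodn_gt0 => v; case: (hn v).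
apply: functional_extensionality_dep => v; rewrite vprodX (bigD1 v) //= expgnA.
by have [_ ->] := hn v; rewrite expg1n.
Qed.

Section Weight.
Local Open Scope ring_scope.
Variable N : forall v : vertex GG, vgroup v -> rat.
Arguments N : clear implicits.
Hypothesis gwN : graph_weight [set: edge GG]%SET N.

Definition vprod_weight b : rat := \sum_v N v (b v).

Let wN v : is_weight (N v). Proof. by case: gwN. Qed.

Lemma weight_ge0 v g : 0 <= N v g.
Proof.
case: (pselect (infinite_order g)) => h; last by rewrite weight_finite_order.
by case: (wN v) => /(_ g h)/ltW.
Qed.

Lemma weight1 v : N v 1%g = 0.
Proof. by apply: weight_finite_order => // /(_ 1%N isT); apply; apply: expg1n. Qed.

Lemma vprod_weight_single v g : vprod_weight (single v g) = N v g.
Proof.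
rewrite /vprod_weight (bigD1 v) //= single_in big1 ?addr0 // => w vw.
by rewrite single_out 1?eq_sym // weight1.
Qed.

Lemma vprod_weight_conj g b : vprod_weight (g * b * g^-1)%g = vprod_weight b.
Proof. by apply: eq_bigr => v _; case: (wN v) => _ _ _ /(_ (g v) (b v)). Qed.

Lemma vprod_weight_edge e (c : egroup e) :
  vprod_weight (vphipm e c) = vprod_weight (vphimm e c).
Proof. by rewrite !vprod_weight_single; case: gwN => _; apply; rewrite inE. Qed.

Lemma vprod_weightX b n : vprod_weight (b ^+ n)%g = vprod_weight b *+ n.
Proof.
rewrite /vprod_weight -sumrMnl; apply: eq_bigr => v _.
by rewrite vprodX; case: (wN v).
Qed.

Lemma vprod_weight_pos b : infinite_order b -> 0 < vprod_weight b.
Proof.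
case/infinite_order_coord => v binf; rewrite /vprod_weight (bigD1 v) //=.
apply: ltr_pwDl; first by case: (wN v) => /(_ _ binf).
by apply: sumr_ge0 => w _; apply: weight_ge0.
Qed.

Lemma vhnn_no_almost_BS (a s : vhnn) p q :
    (0 < p)%N -> (p < q)%N -> (s * a ^+ p * s^-1)%g = (a ^+ q)%g ->
  ~ infinite_order a.
Proof.
exact: (hnn_no_almost_BS vprod_weight_conj vprod_weight_edge vprod_weightX vprod_weight_pos).
Qed.

End Weight.
End VertexProduct.

Section TwistedLift.
Variables (GG : graph_of_groups) (T : {set edge GG}) (K : groupType).
Variables (j : forall v : vertex GG, vgroup v -> K) (t : edge GG -> K).
Hypotheses (jM : forall v, {morph @j v : g h / g * h})
  (t_rel : forall e (c : egroup e), t e * @j _ (phip e c) = @j _ (phim e c) * t e)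
  (acT : acyclic T).

(* The stable letters of the tree need not be trivial in [K]; conjugating each
   vertex group by the potential [gam] makes them so. *)
Lemma twisted_lift : exists (gam : vertex GG -> K) (f : pi1 T -> K),
  [/\ forall e, e \in T -> gam (endm e) * t e = gam (endp e),
      {morph f : x y / x * y},
      forall v (g : vgroup v), f (vertex_in T g) = gam v * j g * (gam v)^-1 &
      forall e, f (stable_letter T e) = gam (endm e) * t e * (gam (endp e))^-1].
Proof.
have [gam gamP] := acyclic_potential t acT.
pose i v (g : vgroup v) := gam v * j g * (gam v)^-1.
pose tau e := gam (endm e) * t e * (gam (endp e))^-1.
have iM v : {morph @i v : g h / g * h} by move=> g h; rewrite /i jM !mulgA mulgVK.
have tau_rel e (c : egroup e) : tau e * @i _ (phip e c) = @i _ (phim e c) * tau e.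
  by rewrite /tau /i !mulgA !mulgVK -(mulgA _ (t e) (j (phip e c))) t_rel !mulgA.
have tau_tree e : e \in T -> tau e = 1 by move=> /gamP h; rewrite /tau h mulgV.
exists gam, (pi1_lift i tau); split=> //.
- exact: pi1_liftM.
- by move=> v g; rewrite pi1_lift_vertex.
- by move=> e; rewrite pi1_lift_stable.
Qed.

End TwistedLift.

(** * Reading normal forms along paths of the graph *)

Section Embedding.
Variables (GG : graph_of_groups) (T : {set edge GG}).

Local Notation F := (vhnn GG).
Local Notation act := (@act (vprod GG) (edge GG) (@egroup GG) (@vphipm GG) (@vphimm GG)
  (@vphip_inj GG) (@vphim_inj GG)).
Local Notation base_in := (@base_in (vprod GG) (edge GG) (@egroup GG) (@vphipm GG) (@vphimm GG)
  (@vphip_inj GG) (@vphim_inj GG)).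
Local Notation stable := (@stable (vprod GG) (edge GG) (@egroup GG) (@vphipm GG) (@vphimm GG)
  (@vphip_inj GG) (@vphim_inj GG)).
Local Notation reduced := (reduced (@vphipm GG) (@vphimm GG)).

(** From [t_e * phip e c = phim e c * t_e], the letter [t_e] has [endm e] on its left. *)
Definition org (d : dir (edge GG)) : vertex GG := if d.2 then endm d.1 else endp d.1.

Definition coord_in (v : vertex GG) (b : vprod GG) : pi1 T := vertex_in T (b v).

Definition readback_pi1 (v0 : vertex GG) (x : nform (vprod GG) (edge GG)) : pi1 T :=
  readback org v0 coord_in (dir_letter (stable_letter T)) x.

Lemma coord_inM v : {morph coord_in v : b b' / b * b'}.
Proof. by move=> b b'; rewrite /coord_in -vertex_inM. Qed.

Lemma coord_in_rel (d : dir (edge GG)) (c : egroup d.1) :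
  dir_letter (stable_letter T) d * coord_in (org (revd d)) (tgt (@vphipm GG) (@vphimm GG) c) =
  coord_in (org d) (src (@vphipm GG) (@vphimm GG) c) * dir_letter (stable_letter T) d.
Proof.
have := @dir_letter_rel (vprod GG) (edge GG) (@egroup GG) (@vphipm GG) (@vphimm GG) (pi1 T)
  (fun b e x => coord_in (if b then endp e else endm e) x) (stable_letter T).
have rel e (c' : egroup e) : stable_letter T e * coord_in (endp e) (vphipm e c') =
    coord_in (endm e) (vphimm e c') * stable_letter T e.
  rewrite /coord_in -[vphipm e c']/(single (phip e c')) -[vphimm e c']/(single (phim e c')).
  rewrite !single_in.
  exact: stable_letter_rel.
by move=> /(_ rel d c); case: d c => e [].
Qed.

Variable v0 : vertex GG.

Local Notation path_from := (path_from org v0).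

(* [h], acting on paths from [v], is covered by left multiplication by [k]. *)
Definition carries v w (h : F) (k : pi1 T) : Prop :=
  forall x, reduced x.1 -> path_from v x.1 ->
  path_from w (act h x).1 /\ readback_pi1 v0 (act h x) = k * readback_pi1 v0 x.

Lemma carriesM u v w h k h' k' : carries v w h k -> carries u v h' k' ->
  carries u w (h * h') (k * k').
Proof.
move=> c c' x hx px; have [p1 e1] := c' x hx px.
have [p2 e2] := c _ (reduced_act h' hx) p1.
by rewrite actM // e2 e1 mulgA.
Qed.

Lemma carries_base v (g : vgroup v) : carries v v (base_in (single g)) (vertex_in T g).
Proof.
move=> x hx px; rewrite act_base //.
have [p e] := readback_bact coord_inM coord_in_rel (single g) px.
by split=> //; rewrite /readback_pi1 e /coord_in single_in.
Qed.

Lemma carries_stable d :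
  carries (org (revd d)) (org d) (stable d) (dir_letter (stable_letter T) d).
Proof.
move=> x hx px; rewrite act_stable //.
have [p e] := readback_tact coord_inM (dir_letter_revd (stable_letter T)) px.
by split.
Qed.

Lemma carries_one v : carries v v 1 1.
Proof. by move=> x hx px; rewrite act1 // mul1g. Qed.

End Embedding.

Section TreeEmbedding.
Variables (GG : graph_of_groups) (T : {set edge GG}).
Hypothesis T_tree : spanning_tree T.

Definition vhnn_vertex v (g : vgroup v) : vhnn GG :=
  @base_in _ _ _ _ _ (@vphip_inj GG) (@vphim_inj GG) (@single GG v g).

Definition vhnn_edge (e : edge GG) : vhnn GG :=
  @stable _ _ _ _ _ (@vphip_inj GG) (@vphim_inj GG) (e, true).

Lemma vhnn_lift : exists (gam : vertex GG -> vhnn GG) (f : pi1 T -> vhnn GG),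
  [/\ forall e, e \in T -> gam (endm e) * vhnn_edge e = gam (endp e),
      {morph f : x y / x * y},
      forall v (g : vgroup v), f (vertex_in T g) = gam v * vhnn_vertex g * (gam v)^-1 &
      forall e, f (stable_letter T e) = gam (endm e) * vhnn_edge e * (gam (endp e))^-1].
Proof.
apply: twisted_lift; last by case: T_tree.
  by move=> v g h; rewrite /vhnn_vertex singleM base_inM.
move=> e c.
exact: (@stable_rel _ _ _ _ _ (@vphip_inj GG) (@vphim_inj GG) (e, true) c).
Qed.

Lemma vhnn_embedding : exists (f : pi1 T -> vhnn GG),
  {morph f : x y / x * y} /\ injective f.
Proof.
have [[n0 conn] _] := T_tree; have [v0 _] := card_gt0P n0; pose t := vhnn_edge.
have [gam [f [gamP fM fv ft]]] := vhnn_lift.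
exists f; split=> //.
pose C := @carries GG T v0.
have step (e : edge GG) : C (endp e) (endm e) (t e) (stable_letter T e).
  exact: (@carries_stable GG T v0 (e, true)).
have stepV (e : edge GG) : C (endm e) (endp e) (t e)^-1 (stable_letter T e)^-1.
  exact: (@carries_stable GG T v0 (e, false)).
(* Conjugating by [g0] turns each [f x] into an element that carries forms based at [v0] to forms
   based at [v0]. *)
pose g0 := (gam v0)^-1.
(* Up to [g0], [gam v] is a product of letters along a tree path, and tree letters read back as [1]
   in [pi1 T]. *)
have Cgam v : C v v0 (g0 * gam v) 1 /\ C v0 v (g0 * gam v)^-1 1.
  have /connectP[p + ->] := conn v0 v.
  elim/last_ind: p => [|p w IHp] /=.
    by rewrite /g0 mulVg invg1; split; apply: carries_one.
  rewrite rcons_path last_rcons => /andP[/IHp[C1 C2]] /adjP[e eT [[e1 e2]|[e1 e2]]];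
    subst w; rewrite e1 in C1 C2; have te1 := stable_letter_tree eT.
    have -> : gam (endm e) = gam (endp e) * (t e)^-1 by rewrite -(gamP e eT) mulgK.
    split; first by have := carriesM C1 (stepV e); rewrite te1 invg1 mulg1 mulgA.
    have := carriesM (step e) C2; rewrite te1 mulg1.
    by rewrite !invgM !invgK -?mulgA.
  have -> : gam (endp e) = gam (endm e) * t e by rewrite -(gamP e eT).
  split; first by have := carriesM C1 (step e); rewrite te1 mulg1 mulgA.
  have := carriesM (stepV e) C2; rewrite te1 invg1 mulg1.
  by rewrite !invgM -?mulgA.
have Cf x : C v0 v0 (g0 * f x * g0^-1) x.
  have f1 : f 1 = 1 by apply: morph_mulg1.
  have split_conj y z : g0 * f (y * z) * g0^-1 = (g0 * f y * g0^-1) * (g0 * f z * g0^-1).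
    by rewrite fM !mulgA mulgVK.
  have Ce e : C v0 v0 (g0 * f (stable_letter T e) * g0^-1) (stable_letter T e).
    have := carriesM (Cgam (endm e)).1 (carriesM (step e) (Cgam (endp e)).2).
    by rewrite mul1g mulg1 ft invgM !mulgA.
  have CeV e : C v0 v0 (g0 * f (stable_letter T e)^-1 * g0^-1) (stable_letter T e)^-1.
    have := carriesM (Cgam (endp e)).1 (carriesM (stepV e) (Cgam (endm e)).2).
    by rewrite mul1g mulg1 (morph_mulgV fM) ft !invgM !invgK !mulgA.
  elim/pi1_gen_ind: x => [|v g x IHx|e x IHx|e x IHx].
  - by rewrite f1 mulg1 mulgV; apply: carries_one.
  - rewrite split_conj; apply: carriesM IHx.
    have := carriesM (Cgam v).1 (carriesM (carries_base (v0 := v0) T g) (Cgam v).2).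
    by rewrite mul1g mulg1 fv invgM !mulgA.
  - by rewrite split_conj; apply: carriesM (Ce e) IHx.
  - by rewrite split_conj; apply: carriesM (CeV e) IHx.
(* Acting on the trivial form and reading back recovers [x] from [f x]. *)
have ker x : f x = 1 -> x = 1.
  move=> fx; have := Cf x; rewrite fx mulg1 mulgV => /(_ (origin _ _) isT erefl)[_].
  rewrite act1 // /readback_pi1 /readback /= /coord_in.
  by rewrite -[in LHS](mul1g (vertex_in _ _)) => /mulIg.
move=> x y e; apply: (mulIg y^-1); rewrite mulgV; apply: ker.
by rewrite fM (morph_mulgV fM) e mulgV.
Qed.

Lemma vertex_in_inj (v : vertex GG) : injective (@vertex_in GG T v).
Proof.
have [gam [f [_ _ fv _]]] := vhnn_lift.
by move=> g h /(congr1 f); rewrite !fv => /mulIg/mulgI/base_in_inj/single_inj.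
Qed.

End TreeEmbedding.

(** The order of [s] is automatic: [s ^+ n = 1] would give [a ^+ (p ^ n) = a ^+ (q ^ n)] with
    [p < q]. *)
Lemma almost_BS_of_rel (G : groupType) (a s : G) (i j : int) :
    infinite_order a -> i <> 0%R -> j <> 0%R -> absz i <> absz j ->
    s * expgz a i * s^-1 = expgz a j ->
  exists H : set G, non_Euclidean_almost_BS H.
Proof.
move=> ainf i0 j0 ij rel; exists (generated [set a; s]%classic), a, s; split=> //.
  move=> n n0 sn; have [s' [p [q [p0 lt rel' s1]]]] := almost_BS_nat ainf i0 j0 ij rel.
  have := conj_expg_iter n rel'; rewrite (s1 _ sn) mul1g invg1 mulg1.
  by move/(expg_inj ainf)/eqP; rewrite eqn_exp2r // => /eqP e; rewrite e ltnn in lt.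
by exists i, j.
Qed.

(** * Unbalanced edges and almost Baumslag--Solitar subgroups *)

Section MainTheorem.
Variables (GG : graph_of_groups) (T : {set edge GG}).
Hypothesis T_tree : spanning_tree T.

Lemma unbalanced_almost_BS (e : edge GG) : unbalanced e ->
  exists H : set (pi1 T), non_Euclidean_almost_BS H.
Proof.
move=> unb; apply: contrapT => noBS; apply: unb.
move=> conn T' [_ acT'] c cinf h i j rel; apply: contrapT => ij; apply: noBS.
(* The tree [T'] of the complement is unrelated to [T], so its edges may have nontrivial stable
   letters in [pi1 T]; hence the twisted lift. *)
have [gam [f [_ fM fv _]]] := @twisted_lift (remove_edge e) T' (pi1 T)
  (fun v => @vertex_in GG T v) (fun f => stable_letter T (val f))
  (fun v => @vertex_inM GG T v) (fun f => @stable_letter_rel GG T (val f)) acT'.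
pose t := stable_letter T e.
pose al := vertex_in T (phip e c).
have alinf : infinite_order al.
  move=> n n0; rewrite /al -(morph_mulgX (@vertex_inM GG T _)) -phipX.
  rewrite -(vertex_in1 T (endp e)) => /(vertex_in_inj T_tree).
  rewrite -(morph_mulg1 (edge_mapM (phip e))) => /phip_inj; exact: cinf.
have be : vertex_in T (phim e c) = t * al * t^-1.
  by apply/esym/conjg_mulP; apply: stable_letter_rel.
have {}rel : f h * (gam (endp e) * expgz al i * (gam (endp e))^-1) * (f h)^-1 =
    gam (endm e) * (t * expgz al j * t^-1) * (gam (endm e))^-1.
  have := congr1 f rel; rewrite !fM (morph_mulgV fM) !(morph_expgz fM).
  by rewrite /edge_inp /edge_inm !fv be -!conj_expgz.
(* The factors [gam] undo the twist at both ends of [e], and [t^-1] brings the image of [phim e c]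
   back to [al]. *)
pose s := t^-1 * (gam (endm e))^-1 * f h * gam (endp e).
have {}rel : s * expgz al i * s^-1 = expgz al j.
  apply/conjg_mulP; apply: (mulgI (gam (endm e) * t)); move/conjg_mulP: rel.
  by move/(congr1 (fun x => x * gam (endp e)));
     rewrite /s !mulgA !mulgVK mulgK mulgV mul1g => ->.
(* The exponents witnessing unbalancedness may be zero; as [al] has infinite order, both would then
   vanish, against [ij]. *)
have z0 k : expgz al k = 1 -> absz k = 0%N.
  by case: (expgz_abs al k) => ->; [|move/eqP; rewrite invg_eq1 => /eqP];
     case: (absz k) => // m /(alinf m.+1 isT).
apply: (almost_BS_of_rel alinf _ _ ij rel) => k0; apply: ij; rewrite k0.
  apply/esym/z0; move: rel; rewrite k0 => <-.
  by rewrite -[expgz al 0%R]/(1 : pi1 T) mulg1 mulgV.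
apply: z0; move: rel; rewrite k0 => /conjg_mulP.
by rewrite -[expgz al 0%R]/(1 : pi1 T) mul1g -{2}[s]mulg1 => /mulgI.
Qed.

Lemma balanced_no_almost_BS :
    connected_graph GG -> (forall v : vertex GG, finitely_generated (vgroup v)) ->
    (forall e : edge GG, two_ended (egroup e)) ->
    (forall (v : vertex GG) (g : vgroup v), ~ distorted g) ->
    (forall e : edge GG, balanced e) ->
  ~ exists H : set (pi1 T), non_Euclidean_almost_BS H.
Proof.
move=> conn fg te und bal [_ [a [s [ainf _ _ [i [j [i0 j0 ij rel]]]]]]].
have wex (v : vertex GG) : exists N : vgroup v -> rat, is_weight N.
  by apply: weight_exists => g p q ginf; apply: undistorted_conj_pm.
have [N gw] := graph_weight_exists conn bal te wex.
have [s' [p [q [p0 lt rel' _]]]] := almost_BS_nat ainf i0 j0 ij rel.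
have [f [fM finj]] := vhnn_embedding T_tree.
apply: (@vhnn_no_almost_BS GG N gw (f a) (f s') p q p0 lt).
  by rewrite -!(morph_mulgX fM) -(morph_mulgV fM) -!fM rel'.
move=> n n0; rewrite -(morph_mulgX fM) -(morph_mulg1 fM) => /finj.
exact: ainf.
Qed.

End MainTheorem.

Theorem theorem1p3 (GG : graph_of_groups) (T : {set edge GG})
  (GG_connected : connected_graph GG)
  (T_spanning : spanning_tree T)
  (vertex_fg : forall v : vertex GG, finitely_generated (vgroup v))
  (edge_two_ended : forall e : edge GG, two_ended (egroup e))
  (undistorted : forall (v : vertex GG) (g : vgroup v), ~ distorted g) :
  (exists H : set (pi1 T), non_Euclidean_almost_BS H) <->
  (exists e : edge GG, unbalanced e).
Proof.
split=> [BS|[e]]; last exact: unbalanced_almost_BS.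
apply: contrapT => no.
by apply: (balanced_no_almost_BS T_spanning) BS => // e; apply: contrapT => h;
   apply: no; exists e.
Qed.
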